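(* Let $\tilde M^{n+1}$, $n\geq 2$, be an oriented Riemannian manifold, let $\xi$ be a nontrivial closed conformal vector field on $\tilde M$ with conformal factor $\psi_\xi$, and let $\Xi$ be a leaf of $\xi^\bot$, with the metric of $\tilde M$ normalized by a constant factor so that $\langle\xi,\xi\rangle=1$ on $\Xi$. If $\eta$ is another closed conformal vector field on $\tilde M$, with conformal factor $\psi_\eta$, and $U=\eta-\langle\eta,\xi\rangle\xi$ along $\Xi$, then $U$ is a closed conformal vector field on $\Xi$ (with the induced metric), with conformal factor $\psi_U=\psi_\eta-\psi_\xi\langle\eta,\xi\rangle$.
   Context: A smooth vector field $\xi$ on a Riemannian manifold with Levi-Civita connection $\nabla$ is closed conformal with conformal factor the smooth function $\psi_\xi$ if $\nabla_X\xi=\psi_\xi X$ for all vector fields $X$. On the open set where $\xi\ne0$, $\xi^\bot$ is the distribution of vectors orthogonal to $\xi$; it is integrable when $\xi$ is closed conformal. A leaf $\Xi$ is a (connected) maximal integral hypersurface; $\langle\xi,\xi\rangle$ is constant on each leaf. *)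

(* Defs.v *)
From HB Require Import structures.
From mathcomp Require Import all_boot all_order all_algebra.
From mathcomp Require Import all_classical all_reals all_analysis.

Set Implicit Arguments.
Unset Strict Implicit.
Unset Printing Implicit Defensive.

Import Order.TTheory GRing.Theory Num.Theory.
Import numFieldNormedType.Exports.

Local Open Scope classical_set_scope.
Local Open Scope ring_scope.

Definition partial (R : realType) (m : nat) (a : 'I_m)
    (f : 'rV[R]_m -> R) (x : 'rV[R]_m) : R :=
  'D_(delta_mx 0 a) f x.

(* Class C^k on a set U, which is open in every use: for k > 0, f is
   differentiable at the points of U and its partial derivatives are of class
   C^(k-1) on U. *)
Fixpoint Ck (R : realType) (m k : nat) (U : set 'rV[R]_m)
    (f : 'rV[R]_m -> R) : Prop :=
  if k is k'.+1 then
    (forall x, U x -> differentiable f x) /\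
    (forall a, Ck k' U (partial a f))
  else forall x, U x -> {for x, continuous f}.

Definition smooth_on (R : realType) (m : nat) (U : set 'rV[R]_m)
    (f : 'rV[R]_m -> R) : Prop :=
  forall k, Ck k U f.

Definition smooth_mx_on (R : realType) (m p q : nat) (U : set 'rV[R]_m)
    (f : 'rV[R]_m -> 'M[R]_(p, q)) : Prop :=
  forall i j, smooth_on U (fun x => f x i j).

(* A smooth m-manifold, given by a (not necessarily maximal) smooth atlas on a
   Hausdorff second countable space. [param i] is the inverse of [chart i] on
   [chart i @` dom i]; the values of [chart i] off [dom i] and of [param i] off
   [chart i @` dom i] are irrelevant. [chart_at p] selects, once and for all,
   a chart around p. *)
Record manifold (R : realType) (m : nat) := Manifold {
  space :> topologicalType;
  hausdorff_axiom : hausdorff_space space;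
  countable_axiom : @second_countable space;
  chart_index : Type;
  dom : chart_index -> set space;
  chart : chart_index -> space -> 'rV[R]_m;
  param : chart_index -> 'rV[R]_m -> space;
  chart_at : space -> chart_index;
  open_dom : forall i, open (dom i);
  open_cod : forall i, open (chart i @` dom i);
  chartK : forall i p, dom i p -> param i (chart i p) = p;
  chart_continuous : forall i p, dom i p -> {for p, continuous (chart i)};
  param_continuous : forall i x, (chart i @` dom i) x ->
    {for x, continuous (param i)};
  transition_smooth : forall i j,
    smooth_mx_on (chart i @` (dom i `&` dom j)) (chart j \o param i);
  dom_chart_at : forall p, dom (chart_at p) p
}.

Arguments dom {_ _ _} _ _.
Arguments chart {_ _ _} _ _.
Arguments param {_ _ _} _ _.
Arguments chart_at {_ _ _} _.

Definition cod (R : realType) (m : nat) (M : manifold R m) (i : chart_index M) :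
    set 'rV[R]_m :=
  chart i @` dom i.

(* Jacobian matrix, at the point p, of the change of coordinates from chart i
   to chart j; row vectors of components transform by v |-> v *m change i j p. *)
Definition change (R : realType) (m : nat) (M : manifold R m)
    (i j : chart_index M) (p : M) : 'M[R]_m :=
  jacobian (chart j \o param i) (chart i p).

(* Orientation, as an atlas with orientation-preserving coordinate changes. *)
Definition oriented (R : realType) (m : nat) (M : manifold R m) : Prop :=
  forall (i j : chart_index M) (p : M), dom i p -> dom j p ->
    0 < \det (change i j p).

Definition smooth_fun (R : realType) (m : nat) (M : manifold R m)
    (f : M -> R) : Prop :=
  forall i : chart_index M, smooth_on (cod i) (f \o param i).

Definition smooth_map (R : realType) (n m : nat) (N : manifold R n)
    (M : manifold R m) (F : N -> M) : Prop :=
  continuous F /\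
  forall (i : chart_index N) (j : chart_index M),
    smooth_mx_on (chart i @` (dom i `&` (F @^-1` dom j)))
      (chart j \o F \o param i).

(* A tangent vector at p is represented by its row vector of components in the
   chart [chart_at p]. A vector field, smooth or not, is then a function
   M -> 'rV[R]_m, and a field of bilinear forms a function M -> 'M[R]_m. The
   following two definitions give their components in an arbitrary chart i, as
   functions of the coordinates x in that chart. *)
Definition field_in (R : realType) (m : nat) (M : manifold R m)
    (X : M -> 'rV[R]_m) (i : chart_index M) (x : 'rV[R]_m) : 'rV[R]_m :=
  let p := param i x in X p *m change (chart_at p) i p.

Definition form_in (R : realType) (m : nat) (M : manifold R m)
    (g : M -> 'M[R]_m) (i : chart_index M) (x : 'rV[R]_m) : 'M[R]_m :=
  let p := param i x in
  let J := change i (chart_at p) p in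
  J *m g p *m J^T.

Definition smooth_field (R : realType) (m : nat) (M : manifold R m)
    (X : M -> 'rV[R]_m) : Prop :=
  forall i : chart_index M, smooth_mx_on (cod i) (field_in X i).

Definition inner (R : realType) (m : nat) (M : manifold R m)
    (g : M -> 'M[R]_m) (p : M) (u v : 'rV[R]_m) : R :=
  (u *m g p *m v^T) 0 0.

Definition riemannian_metric (R : realType) (m : nat) (M : manifold R m)
    (g : M -> 'M[R]_m) : Prop :=
  [/\ forall i : chart_index M, smooth_mx_on (cod i) (form_in g i),
      forall p u v, inner g p u v = inner g p v u &
      forall p v, v != 0 -> 0 < inner g p v v].

(* Christoffel symbol Gamma^k_(a b) of the Levi-Civita connection in chart i. *)
Definition christoffel (R : realType) (m : nat) (M : manifold R m)
    (g : M -> 'M[R]_m) (i : chart_index M) (x : 'rV[R]_m) (k a b : 'I_m) : R :=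
  let dg c d e := partial c (fun y => form_in g i y d e) x in
  2^-1 * \sum_(l < m)
    invmx (form_in g i x) k l * (dg a b l + dg b a l - dg l a b).

(* Levi-Civita covariant derivative nabla_X Y, whose components at p are
   computed in the chart [chart_at p], where X has the components X p. *)
Definition nabla (R : realType) (m : nat) (M : manifold R m)
    (g : M -> 'M[R]_m) (X Y : M -> 'rV[R]_m) (p : M) : 'rV[R]_m :=
  let i := chart_at p in
  let x := chart i p in
  \row_(k < m)
    (\sum_(a < m) X p 0 a * partial a (fun y => field_in Y i y 0 k) x +
     \sum_(a < m) \sum_(b < m) christoffel g i x k a b * X p 0 a * Y p 0 b).

Definition closed_conformal (R : realType) (m : nat) (M : manifold R m)
    (g : M -> 'M[R]_m) (xi : M -> 'rV[R]_m) (psi : M -> R) : Prop :=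
  [/\ smooth_field xi,
      smooth_fun psi &
      forall X : M -> 'rV[R]_m, smooth_field X ->
        forall p, nabla g X xi p = psi p *: X p].

(* Matrix of the differential of F at q: T_q N -> T_(F q) M is
   w |-> w *m tangent_map F q. *)
Definition tangent_map (R : realType) (n m : nat) (N : manifold R n)
    (M : manifold R m) (F : N -> M) (q : N) : 'M[R]_(n, m) :=
  jacobian (chart (chart_at (F q)) \o F \o param (chart_at q))
    (chart (chart_at q) q).

Definition induced_metric (R : realType) (n m : nat) (N : manifold R n)
    (M : manifold R m) (F : N -> M) (g : M -> 'M[R]_m) (q : N) : 'M[R]_n :=
  tangent_map F q *m g (F q) *m (tangent_map F q)^T.

Definition xi_orthogonal (R : realType) (m : nat) (M : manifold R m)
    (g : M -> 'M[R]_m) (xi : M -> 'rV[R]_m) (p : M) : set 'rV[R]_m :=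
  [set v | inner g p v (xi p) = 0].

(* Connected integral manifolds of the orthogonal distribution of xi, which
   lives on the open set xi <> 0, as injectively immersed manifolds. *)
Definition integral_manifold (R : realType) (n m : nat) (M : manifold R m)
    (g : M -> 'M[R]_m) (xi : M -> 'rV[R]_m)
    (N : manifold R n) (F : N -> M) : Prop :=
  [/\ [set: N] !=set0 /\ connected [set: N],
      smooth_map F,
      injective F /\ (forall q, row_free (tangent_map F q)),
      forall q, xi (F q) != 0 &
      forall q, range (fun w : 'rV[R]_n => w *m tangent_map F q) =
                xi_orthogonal g xi (F q)].

Definition leaf (R : realType) (n m : nat) (M : manifold R m)
    (g : M -> 'M[R]_m) (xi : M -> 'rV[R]_m)
    (N : manifold R n) (F : N -> M) : Prop :=
  integral_manifold g xi F /\
  forall (N' : manifold R n) (F' : N' -> M),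
    integral_manifold g xi F' -> range F `<=` range F' ->
    range F' `<=` range F.

(* Main.v *)
(* In coordinates, lowering the index of the Levi-Civita derivative with the
   metric G turns it into the expression [lowered_nabla], which involves only
   first derivatives of G and no inverse matrix. For an immersion F with
   Jacobian matrix J, the induced metric is J G J^T, and the symmetry of the
   second derivatives of F makes all terms with derivatives of J cancel except
   the one that completes the derivative of u to that of V = u J: this is the
   Gauss formula, with no projection needed since only tangent vectors are
   paired with. For V = eta - f xi, f = <eta, xi>, conformality of eta and xi
   gives the multiple psi_eta - f psi_xi of the induced metric, and the term
   in df disappears because xi is normal to the leaf.
   The closed conformal equation is assumed for global smooth fields only, so
   bump functions are needed to get it for every tangent vector at a point. *)

Require Import Defs.
From HB Require Import structures.
From mathcomp Require Import all_boot all_order all_algebra.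
From mathcomp Require Import all_classical all_reals all_analysis.
From mathcomp Require Import ring lra.

Set Implicit Arguments.
Unset Strict Implicit.
Unset Printing Implicit Defensive.

Import Order.TTheory GRing.Theory Num.Theory.
Import numFieldNormedType.Exports.

Local Open Scope classical_set_scope.
Local Open Scope ring_scope.

(** * Differentiating matrix-valued functions *)

Section MatrixCalculus.
Variables (R : realType) (V : normedModType R).

Lemma differentiable_mx p q (f : V -> 'M[R]_(p, q)) x :
  (forall i j, differentiable (fun y => f y i j) x) -> differentiable f x.
Proof.
move=> df.
have -> : f = \sum_(i < p) \sum_(j < q) (fun y => f y i j *: delta_mx i j).
  apply/funext => y; rewrite [LHS]matrix_sum_delta fct_sumE.
  by apply: eq_bigr => i _; rewrite fct_sumE.
by apply: differentiable_sum => i; apply: differentiable_sum => j;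
  apply: differentiableZl.
Qed.

Lemma differentiable_entry p q (f : V -> 'M[R]_(p, q)) x i j :
  differentiable f x -> differentiable (fun y => f y i j) x.
Proof.
move=> df; apply: (@differentiable_comp _ _ _ _ f (fun A => A i j)) => //.
exact: differentiable_coord.
Qed.

Lemma derive_entry p q (f : V -> 'M[R]_(p, q)) x v i j :
  differentiable f x -> ('D_v f x) i j = 'D_v (fun y => f y i j) x.
Proof.
by move=> /(@diff_derivable _ _ _ _ _ v) /derive_mx ->; rewrite mxE.
Qed.

Lemma differentiable_mulmx p q r (f : V -> 'M[R]_(p, q)) (g : V -> 'M[R]_(q, r)) x :
  differentiable f x -> differentiable g x ->
  differentiable (fun y => f y *m g y) x.
Proof.
move=> df dg; apply: differentiable_mx => i j.
have -> : (fun y => (f y *m g y) i j) =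
   \sum_(k < q) ((fun y => f y i k) * (fun y => g y k j)).
  by apply/funext => y; rewrite mxE fct_sumE.
by apply: differentiable_sum => k; apply: differentiableM;
  apply: differentiable_entry.
Qed.

Lemma derive_mulmx p q r (f : V -> 'M[R]_(p, q)) (g : V -> 'M[R]_(q, r)) x v :
  differentiable f x -> differentiable g x ->
  'D_v (fun y => f y *m g y) x = 'D_v f x *m g x + f x *m 'D_v g x.
Proof.
move=> df dg; apply/matrixP => i j.
rewrite derive_entry; last exact: differentiable_mulmx.
have -> : (fun y => (f y *m g y) i j) =
   \sum_(k < q) ((fun y => f y i k) * (fun y => g y k j)).
  by apply/funext => y; rewrite mxE fct_sumE.
have dfe i' k : derivable (fun y => f y i' k) x v.
  exact/diff_derivable/differentiable_entry.
have dge k j' : derivable (fun y => g y k j') x v.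
  exact/diff_derivable/differentiable_entry.
rewrite derive_sum; last by move=> k; apply: derivableM.
rewrite !mxE -big_split /=; apply: eq_bigr => k _.
rewrite deriveM // -!derive_entry // addrC; congr (_ + _).
by rewrite mulrC.
Qed.

Lemma differentiable_trmx p q (f : V -> 'M[R]_(p, q)) x :
  differentiable f x -> differentiable (fun y => (f y)^T) x.
Proof.
move=> df; apply: differentiable_mx => i j.
under eq_fun do rewrite mxE; exact: differentiable_entry.
Qed.

Lemma derive_trmx p q (f : V -> 'M[R]_(p, q)) x v :
  differentiable f x -> 'D_v (fun y => (f y)^T) x = ('D_v f x)^T.
Proof.
move=> df; apply/matrixP => i j.
rewrite derive_entry; last exact: differentiable_trmx.
under eq_fun do rewrite mxE; by rewrite mxE derive_entry.
Qed.

Lemma derive_comp (W W' : normedModType R) (f : V -> W) (g : W -> W') x v :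
  differentiable f x -> differentiable g (f x) ->
  'D_v (g \o f) x = 'D_('D_v f x) g (f x).
Proof.
move=> df dg; rewrite !deriveE //; last exact: differentiable_comp.
by rewrite diff_comp.
Qed.

Lemma derive_linear (W : normedModType R) (f : V -> W) x :
  differentiable f x -> linear (fun v => 'D_v f x).
Proof. by move=> df a u v; rewrite !deriveE // linearP. Qed.

Lemma deriveZfun q (k : V -> R) (f : V -> 'rV[R]_q) x v :
  differentiable k x -> differentiable f x ->
  'D_v (fun y => k y *: f y) x = 'D_v k x *: f x + k x *: 'D_v f x.
Proof.
move=> dk df.
have dkf : differentiable (fun y => k y *: f y) x.
  apply: differentiable_mx => i j; under eq_fun do rewrite mxE.
  by apply: differentiableM => //; apply: differentiable_entry.
apply/rowP => j; rewrite derive_entry //.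
under eq_fun do rewrite mxE.
rewrite !mxE derive_entry // (deriveM (f := k) (g := fun y => f y 0 j));
  try exact: diff_derivable.
  by rewrite addrC; congr (_ + _); apply: mulrC.
exact/diff_derivable/differentiable_entry.
Qed.

Lemma differentiableZfun q (k : V -> R) (f : V -> 'rV[R]_q) x :
  differentiable k x -> differentiable f x ->
  differentiable (fun y => k y *: f y) x.
Proof.
move=> dk df; apply: differentiable_mx => i j; under eq_fun do rewrite mxE.
by apply: differentiableM => //; apply: differentiable_entry.
Qed.

(** Near x, [g] has the same first order expansion as [f], so ['d f x] serves as its differential,
    and [diff_unique] identifies it with ['d g x]. *)
Lemma near_eq_differentiable (W : normedModType R) (f g : V -> W) x :
  {near x, f =1 g} -> differentiable f x -> differentiable g x.
Proof.
move=> fg df.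
have eg : g \o shift x = cst (g x) + 'd f x +o_ 0 id.
  have /eqaddoP ef := diff_locally df.
  apply/eqaddoP => e e0; have {}ef := ef e e0.
  have fg0 : \forall h \near 0, f (h + x) = g (h + x).
    by move: fg; rewrite (near_shift 0) /= subr0.
  near=> h; rewrite /= !fctE /= -(near fg0 h) // -(nbhs_singleton fg).
  by near: h; exact: ef.
have gd := diff_unique (diff_continuous df) eg.
by apply/diff_locallyP; rewrite gd; split => //; exact: diff_continuous.
Unshelve. all: by end_near. Qed.
End MatrixCalculus.

(** * Symmetry of second derivatives *)

Section SecondDerivatives.
Variable R : realType.

Lemma MVT_line (V : normedModType R) (f : V -> R) (x v : V) (h : R) :
  0 < h -> (forall c, 0 <= c <= h -> differentiable f (c *: v + x)) ->
  exists2 c, 0 <= c <= h & f (h *: v + x) - f x = 'D_v f (c *: v + x) * h.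
Proof.
move=> h0 df; pose g (t : R) := f (t *: v + x).
have dline t : differentiable (fun t : R => t *: v + x) t.
    have -> : (fun t : R => t *: v + x) = ( *:%R ^~ v) + cst x by [].
    exact: differentiableD.
have Dline t : 'D_1 (fun t : R => t *: v + x) t = v.
    have -> : (fun t : R => t *: v + x) = ( *:%R ^~ v) + cst x by [].
    rewrite deriveD; [|exact: diff_derivable|exact: derivable_cst].
    by rewrite derive_cst addr0 deriveE // diff_val scale1r.
have dg t : 0 <= t <= h -> is_derive t 1 g ('D_v f (t *: v + x)).
  move=> /df dft; have dgt : differentiable g t.
    by apply: (@differentiable_comp _ _ _ _ (fun t : R => t *: v + x) f).
  apply: DeriveDef; first exact: diff_derivable.
  by rewrite (derive_comp (f := fun t : R => t *: v + x) (g := f)) // Dline.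
have [||c ch] := @MVT R g (fun t => 'D_v f (t *: v + x)) 0 h h0.
- move=> t /[!in_itv]/= /andP[t0 th]; apply: dg; by rewrite !ltW.
- apply: derivable_within_continuous => t /[!in_itv]/= th.
  by have [] := dg _ th.
- rewrite /g scale0r add0r subr0 => ->; exists c => //.
  by move: ch; rewrite in_itv /= => /andP[? ?]; rewrite !ltW.
Qed.

Lemma derive_translate (V : normedModType R) (f : V -> R) (a y v : V) :
  'D_v (fun z => f (z + a)) y = 'D_v f (y + a).
Proof. by rewrite /derive /=; under eq_fun do rewrite -addrA. Qed.

Lemma differentiable_translate (V : normedModType R) (f : V -> R) (a y : V) :
  differentiable f (y + a) -> differentiable (fun z => f (z + a)) y.
Proof.
move=> df; apply: (@differentiable_comp _ _ _ _ (fun z => z + a) f) => //.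

Qed.

(* Two applications of the mean value theorem; exchanging v and w leaves the
   left-hand side unchanged. *)
Lemma second_difference (V : normedModType R) (f : V -> R) (x v w : V) (h r : R) :
  0 < h -> h * (`|v| + `|w|) < r ->
  (forall y, `|y - x| < r -> differentiable f y) ->
  (forall y, `|y - x| < r -> differentiable ('D_v f) y) ->
  exists2 p, `|p - x| < r &
    f (h *: v + h *: w + x) - f (h *: w + x) - f (h *: v + x) + f x
      = 'D_w ('D_v f) p * h ^+ 2.
Proof.
move=> h0 hr df ddf.
have le_r c d : 0 <= c <= h -> 0 <= d <= h -> `|c *: v + d *: w + x - x| < r.
  move=> /andP[c0 ch] /andP[d0 dh]; rewrite addrK (le_lt_trans _ hr) //.
  rewrite (le_trans (ler_normD _ _)) // !normrZ !ger0_norm // mulrDr.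
  by apply: lerD; apply: ler_wpM2r.
have h00 : (0 : R) <= 0 <= h by apply/andP; split => //; exact: ltW.
have hh : 0 <= h <= h by apply/andP; split => //; exact: ltW.
pose g y := f (y + h *: w) - f y.
have gl c : 0 <= c <= h ->
    differentiable g (c *: v + x) /\
    'D_v g (c *: v + x) = 'D_v f (c *: v + h *: w + x) - 'D_v f (c *: v + x).
  move=> ch.
  have d1 : differentiable f (c *: v + x + h *: w).
    by apply: df; rewrite (addrAC _ x); exact: le_r.
  have d1' := differentiable_translate d1.
  have d2 : differentiable f (c *: v + x).
    by apply: df; have := le_r _ _ ch h00; rewrite scale0r addr0.
  split; first exact: (differentiableB d1' d2).
  rewrite (deriveB (f := fun y => f (y + h *: w)) (g := f));
    [|exact: diff_derivable..].
  by rewrite derive_translate (addrAC _ x).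
have [|c ch] := @MVT_line _ g x v h h0; first by move=> c /gl[].
have [_ ->] := gl _ ch; rewrite /g => e1.
have [|d dh e2] := @MVT_line _ ('D_v f) (c *: v + x) w h h0.
  by move=> d dh; apply: ddf; rewrite addrA (addrC (d *: w)); exact: le_r.
exists (d *: w + (c *: v + x)).
  by rewrite addrA (addrC (d *: w)); exact: le_r.
have -> : f (h *: v + h *: w + x) - f (h *: w + x) - f (h *: v + x) + f x
   = f (h *: v + x + h *: w) - f (h *: v + x) - (f (x + h *: w) - f x).
  rewrite (addrAC _ x) (addrC x); ring.
rewrite e1 expr2 mulrA; congr (_ * _).
by rewrite -e2 addrA (addrC (h *: w)).
Qed.

(** By [second_difference], one and the same second difference divided by [h ^+ 2] is a value of
    ['D_w ('D_v f)] at some p and a value of ['D_v ('D_w f)] at some q, both within r of x.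
    Continuity at x makes these values [e / 2]-close to those at x. *)
Lemma schwarz (V : normedModType R) (f : V -> R) (x v w : V) :
  (\forall y \near x, differentiable f y) ->
  (\forall y \near x, differentiable ('D_v f) y) ->
  (\forall y \near x, differentiable ('D_w f) y) ->
  {for x, continuous ('D_w ('D_v f))} ->
  {for x, continuous ('D_v ('D_w f))} ->
  'D_w ('D_v f) x = 'D_v ('D_w f) x.
Proof.
move=> df dvf dwf cwv cvw.
apply/eqP; rewrite -subr_eq0 -normr_le0; apply/ler_addgt0Pl => e e0.
have e2 : 0 < e / 2 by rewrite divr_gt0.
move/cvgrPdist_lt : cwv => /(_ _ e2) cwv.
move/cvgrPdist_lt : cvw => /(_ _ e2) cvw.
have /nbhs_ballP[r /= r0 xr'] : \forall y \near x, differentiable f y /\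
    differentiable ('D_v f) y /\ differentiable ('D_w f) y /\
    `|'D_w ('D_v f) x - 'D_w ('D_v f) y| < e / 2 /\
    `|'D_v ('D_w f) x - 'D_v ('D_w f) y| < e / 2.
  exact: (filterI df (filterI dvf (filterI dwf (filterI cwv cvw)))).
have xr y : `|y - x| < r -> [/\ differentiable f y,
    differentiable ('D_v f) y, differentiable ('D_w f) y,
    `|'D_w ('D_v f) x - 'D_w ('D_v f) y| < e / 2 &
    `|'D_v ('D_w f) x - 'D_v ('D_w f) y| < e / 2].
  move=> yx; have /xr'[? [? [? [? ?]]]] : ball x r y.
    by rewrite -ball_normE /= distrC.
  by split.
(* The parallelogram spanned at x by [h v] and [h w] stays within distance r of x; the 1 keeps the
   denominator positive when v and w vanish. *)
pose h := r / 2 / (`|v| + `|w| + 1).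
have s0 : 0 < `|v| + `|w| + 1 by rewrite ltr_wpDl // addr_ge0.
have h0 : 0 < h by rewrite !divr_gt0.
have hr : h * (`|v| + `|w|) < r.
  rewrite /h mulrAC ltr_pdivrMr //.
  have : 0 <= `|v| + `|w| by rewrite addr_ge0.
  move: (`|v| + `|w|) => s ?; nra.
have [| |p pr e3] := @second_difference V f x v w h r h0 hr.
- by move=> y /xr[].
- by move=> y /xr[].
have [| | |q qr e4] := @second_difference V f x w v h r h0.
- by rewrite (addrC `|w|).
- by move=> y /xr[].
- by move=> y /xr[].
have pq : 'D_w ('D_v f) p = 'D_v ('D_w f) q.
  have hn : h ^+ 2 != 0 by rewrite expf_neq0 // gt_eqF.
  apply: (mulIf hn); apply: etrans (esym e3) _; apply: etrans e4.
  by rewrite (addrC (h *: v)); congr (_ + _); rewrite addrAC.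
have [_ _ _ h1 _] := xr _ pr.
have [_ _ _ _ h2] := xr _ qr.
rewrite addr0; move: h1 h2; rewrite pq.
move: ('D_w ('D_v f) x) ('D_v ('D_w f) x) ('D_v ('D_w f) q) => A B C.
rewrite (distrC B) => h1 h2; clear - h1 h2; rewrite -(subrKA C).
by rewrite (le_trans (ler_normD _ _)) // (splitr e) lerD // ltW.
Qed.

End SecondDerivatives.

(** * Functions of class C^k *)

Lemma continuous_mx (R : realType) (T : topologicalType) p q
    (f : T -> 'M[R]_(p, q)) x :
  (forall i j, {for x, continuous (fun y => f y i j)}) -> {for x, continuous f}.
Proof.
move=> cf; apply/cvg_ballP => e e0.
have ne ij : \forall y \near x, ball (f x ij.1 ij.2) e (f y ij.1 ij.2).
  by have /cvg_ballP/(_ e e0) := cf ij.1 ij.2.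
have : \forall y \near x, forall ij, ball (f x ij.1 ij.2) e (f y ij.1 ij.2).
  exact: filter_forall.
by apply: filterS => y h; split=> // i j; exact: (h (i, j)).
Qed.

Lemma derive_1dim (R : realType) (phi : R -> R) (t c : R) :
  differentiable phi t -> 'D_c phi t = c * 'D_1 phi t.
Proof.
by move=> dphi; rewrite !deriveE // -[c in LHS]mulr1 -[c * 1]/(c *: 1) linearZ.
Qed.

Section Smoothness.
Variables (R : realType) (m : nat).
Implicit Types (U : set 'rV[R]_m) (f g : 'rV[R]_m -> R) (x : 'rV[R]_m).

Lemma Ck_sub k U U' f : U `<=` U' -> Ck k U' f -> Ck k U f.
Proof.
elim: k f => [|k IH] f UU' /=; first by move=> cf x /UU'; exact: cf.
by move=> [df pf]; split=> [x /UU'|a]; [exact: df|exact: IH].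
Qed.

(* [Ck] is a conjunction of pointwise conditions, so it makes sense on the
   singletons [set x], where it is a condition on the germ at x. *)
Lemma Ck_local k U f : (forall x, U x -> Ck k [set x] f) -> Ck k U f.
Proof.
elim: k f => [|k IH] f /= cf; first by move=> x Ux; exact: (cf x Ux).
split=> [x Ux|a]; first by have [/(_ x erefl)] := cf x Ux.
by apply: IH => x Ux; have [_ /(_ a)] := cf x Ux.
Qed.

Lemma Ck_near_eq k x f g : {near x, f =1 g} -> Ck k [set x] f -> Ck k [set x] g.
Proof.
elim: k f g => [|k IH] f g fg /=.
  move=> cf y ->; apply: cvg_trans; last first.
    by rewrite -(nbhs_singleton fg); exact: (cf x erefl).
  exact: near_eq_cvg fg.
move=> [df pf]; split=> [y ->|a].
  exact: near_eq_differentiable fg (df x erefl).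
apply: (IH (partial a f)) => //.
have fgx : nbhs x (fun y => \near y, f y = g y) by exact: nbhs_interior fg.
by apply: filterS fgx => y; exact: near_eq_derive.
Qed.

Lemma Ck_ext k U f g : open U -> (forall x, U x -> f x = g x) ->
  Ck k U f -> Ck k U g.
Proof.
move=> oU fg cf; apply: Ck_local => x Ux.
apply: (@Ck_near_eq _ _ f); last by apply: Ck_sub cf => _ ->.
by apply: filterS (open_nbhs_nbhs (conj oU Ux)) => y; exact: fg.
Qed.

Lemma Ck_continuous k U f x : Ck k U f -> U x -> {for x, continuous f}.
Proof.
case: k => [|k] /=; first by apply.
by move=> [df _] /df; exact: differentiable_continuous.
Qed.

Lemma Ck_prev k U f : Ck k.+1 U f -> Ck k U f.
Proof.
elim: k f => [|k IH] f; first by move=> /Ck_continuous.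
by move=> [df pf]; split=> // a; apply: IH; exact: pf.
Qed.

Lemma Ck_cst k U (c : R) : Ck k U (cst c).
Proof.
elim: k c => [|k IH] c /=; first by move=> x _; exact: cst_continuous.
split=> [x _|a]; first exact: differentiable_cst.
have -> : partial a (cst c) = cst 0 :> ('rV[R]_m -> R).
  by apply/funext => y; exact: derive_cst.
exact: IH.
Qed.

Lemma Ck_add k U f g : open U -> Ck k U f -> Ck k U g ->
  Ck k U (fun x => f x + g x).
Proof.
move=> oU; elim: k f g => [|k IH] f g /=.
  by move=> cf cg x Ux; exact: cvgD (cf x Ux) (cg x Ux).
move=> [df pf] [dg pg]; split=> [x Ux|a].
  by apply: differentiableD; [exact: df|exact: dg].
apply: (Ck_ext oU) (IH _ _ (pf a) (pg a)) => x Ux; apply/esym.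
by apply: deriveD; apply: diff_derivable; [exact: df|exact: dg].
Qed.

Lemma Ck_mul k U f g : open U -> Ck k U f -> Ck k U g ->
  Ck k U (fun x => f x * g x).
Proof.
move=> oU; elim: k f g => [|k IH] f g.
  by move=> cf cg x Ux; exact: cvgM (cf x Ux) (cg x Ux).
move=> cf cg; have cf' := Ck_prev cf; have cg' := Ck_prev cg.
move: cf cg => /= [df pf] [dg pg]; split=> [x Ux|a].
  by apply: differentiableM; [exact: df|exact: dg].
have c1 := IH _ _ cf' (pg a); have c2 := IH _ _ cg' (pf a).
apply: (Ck_ext oU) (Ck_add oU c1 c2) => x Ux; apply/esym.
by apply: deriveM; apply: diff_derivable; [exact: df|exact: dg].
Qed.

Lemma Ck_sum k U (I : Type) (r : seq I) (P : pred I) (F : I -> 'rV[R]_m -> R) :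
  open U -> (forall i, P i -> Ck k U (F i)) ->
  Ck k U (fun x => \sum_(i <- r | P i) F i x).
Proof.
move=> oU cF; elim: r => [|i r IH].
  apply: Ck_ext (Ck_cst k U 0) => // x _; by rewrite big_nil.
have [Pi|nPi] := boolP (P i); last first.
  by apply: Ck_ext IH => // x _; rewrite big_cons (negbTE nPi).
have cFi := Ck_add oU (cF i Pi) IH.
by apply: Ck_ext cFi => // x _; rewrite big_cons Pi.
Qed.

Lemma Ck_prod k U (I : Type) (r : seq I) (P : pred I) (F : I -> 'rV[R]_m -> R) :
  open U -> (forall i, P i -> Ck k U (F i)) ->
  Ck k U (fun x => \prod_(i <- r | P i) F i x).
Proof.
move=> oU cF; elim: r => [|i r IH].
  apply: Ck_ext (Ck_cst k U 1) => // x _; by rewrite big_nil.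
have [Pi|nPi] := boolP (P i); last first.
  by apply: Ck_ext IH => // x _; rewrite big_cons (negbTE nPi).
have cFi := Ck_mul oU (cF i Pi) IH.
by apply: Ck_ext cFi => // x _; rewrite big_cons Pi.
Qed.

(** Induction on k through the chain rule: each partial derivative of [f \o F] is a sum of products
    of a partial derivative of a coordinate of F and a composite [partial j f \o F], to which the
    induction hypothesis applies. *)
Lemma Ck_comp p k U (U' : set 'rV[R]_p) (F : 'rV[R]_m -> 'rV[R]_p)
    (f : 'rV[R]_p -> R) : open U ->
  (forall x, U x -> U' (F x)) ->
  (forall j, Ck k U (fun x => F x 0 j)) -> Ck k U' f -> Ck k U (f \o F).
Proof.
move=> oU UU'; elim: k f => [|k IH] f.
  move=> cF cf x Ux; apply: continuous_comp; last exact/cf/UU'.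
  by apply: continuous_mx => i j; rewrite ord1; exact: (cF j x Ux).
move=> cF [df pf].
have dF x : U x -> differentiable F x.
  move=> Ux; apply: differentiable_mx => i j; rewrite ord1.
  by case: (cF j) => + _; apply.
split=> [x Ux|a].
  by apply: differentiable_comp; [exact: dF|apply: df; exact: UU'].
pose h := fun x => \sum_j partial a (fun y => F y 0 j) x * (partial j f \o F) x.
apply: (@Ck_ext _ _ h) => //; last first.
  apply: Ck_sum => // j _; apply: Ck_mul => //; first by case: (cF j) => _ /(_ a).
  by apply: IH; [move=> j'; exact/Ck_prev/cF|exact: pf].
move=> x Ux; rewrite /h /partial derive_comp; [|exact: dF|by apply: df; exact: UU'].
rewrite deriveE; last by apply: df; exact: UU'.
rewrite [X in 'd _ _ X]row_sum_delta linear_sum; apply: eq_bigr => j _.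
rewrite linearZ /= -deriveE; last by apply: df; exact: UU'.
by rewrite derive_entry //; exact: dF.
Qed.

(** A whole sequence [phi], each function being the derivative of its predecessor, lets the
    induction on k pass from [phi j] to [phi j.+1]; [flat] is such a sequence. *)
Lemma Ck_scalar_comp k U f (phi : nat -> R -> R) j : open U ->
  (forall i x, U x -> is_derive (f x) 1 (phi i) (phi i.+1 (f x))) ->
  Ck k U f -> Ck k U (phi j \o f).
Proof.
move=> oU dphi; elim: k j => [|k IH] j.
  move=> cf x Ux; apply: continuous_comp; first exact: cf.
  by apply/differentiable_continuous/derivable1_diffP; case: (dphi j x Ux).
move=> cf; have cf' := Ck_prev cf; case: cf => df pf.
have dphi' x : U x -> differentiable (phi j) (f x).
  by move=> Ux; apply/derivable1_diffP; case: (dphi j x Ux).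
split=> [x Ux|a].
  by apply: differentiable_comp; [exact: df|exact: dphi'].
apply: (Ck_ext oU) (Ck_mul oU (pf a) (IH j.+1 cf')) => x Ux.
rewrite {2}/partial derive_comp; [|exact: df|exact: dphi'].
rewrite derive_1dim; last exact: dphi'.
by have [_ ->] := dphi j x Ux.
Qed.

(** The partial derivatives of [1 / f] are products of two factors [1 / f] and a derivative of f, so
    class C^k of [1 / f] gives class C^(k+1). *)
Lemma Ck_inv k U f : open U -> (forall x, U x -> f x != 0) ->
  Ck k U f -> Ck k U (fun x => (f x)^-1).
Proof.
move=> oU f0; elim: k => [|k IH].
  by move=> cf x Ux; exact: cvgV (f0 x Ux) (cf x Ux).
move=> cf; have cf' := IH (Ck_prev cf); case: cf => df pf.
split=> [x Ux|a]; first by apply: differentiableV; [exact: df|exact: f0].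
have c1 := Ck_mul oU (Ck_mul oU cf' cf') (pf a).
apply: (Ck_ext oU) (Ck_mul oU (Ck_cst k U (-1)) c1) => x Ux.
rewrite {2}/partial deriveV; [|exact: f0|exact/diff_derivable/df].
by rewrite mulN1r scaleNr -expr2 exprVn.
Qed.

End Smoothness.

(** * Smooth matrix-valued functions and Jacobian matrices *)

Section SmoothMatrix.
Variables (R : realType) (m : nat).
Implicit Types (U : set 'rV[R]_m) (x : 'rV[R]_m).

Lemma smooth_mx_sub p q U U' (f : 'rV[R]_m -> 'M[R]_(p, q)) :
  U `<=` U' -> smooth_mx_on U' f -> smooth_mx_on U f.
Proof. by move=> UU' sf i j k; exact: Ck_sub UU' (sf i j k). Qed.

Lemma smooth_mx_ext p q U (f g : 'rV[R]_m -> 'M[R]_(p, q)) : open U ->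
  (forall x, U x -> f x = g x) -> smooth_mx_on U f -> smooth_mx_on U g.
Proof.
move=> oU fg sf i j k; apply: (Ck_ext oU) (sf i j k) => x Ux.
by rewrite fg.
Qed.

Lemma smooth_mx_near p q U (f : 'rV[R]_m -> 'M[R]_(p, q)) :
  (forall x, U x -> exists U' g, [/\ open U', U' x, smooth_mx_on U' g &
     forall y, U' y -> g y = f y]) ->
  smooth_mx_on U f.
Proof.
move=> loc i j k; apply: Ck_local => x /loc[U' [g [oU' U'x sg gf]]].
have U'n : nbhs x U' by exact: open_nbhs_nbhs.
apply: (@Ck_near_eq _ _ _ _ (fun y => g y i j)).
  by apply: filterS U'n => y /gf ->.
by apply: Ck_sub (sg i j k) => _ ->.
Qed.

Lemma smooth_mx_differentiable p q U (f : 'rV[R]_m -> 'M[R]_(p, q)) x :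
  smooth_mx_on U f -> U x -> differentiable f x.
Proof.
move=> sf Ux; apply: differentiable_mx => i j.
by have [/(_ x Ux)] := sf i j 1.
Qed.

Lemma smooth_differentiable U (f : 'rV[R]_m -> R) x :
  smooth_on U f -> U x -> differentiable f x.
Proof. by move=> sf Ux; have [/(_ x Ux)] := sf 1. Qed.

Lemma smooth_mul U (f g : 'rV[R]_m -> R) : open U ->
  smooth_on U f -> smooth_on U g -> smooth_on U (fun x => f x * g x).
Proof. by move=> oU sf sg k; exact: Ck_mul. Qed.

Lemma smooth_sub U (f g : 'rV[R]_m -> R) : open U ->
  smooth_on U f -> smooth_on U g -> smooth_on U (fun x => f x - g x).
Proof.
move=> oU sf sg k; apply: (Ck_ext oU _ (Ck_add oU (sf k)
  (Ck_mul oU (Ck_cst k U (-1)) (sg k)))) => x _.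
by rewrite mulN1r.
Qed.

Lemma smooth_comp p U (U' : set 'rV[R]_p) (F : 'rV[R]_m -> 'rV[R]_p)
    (f : 'rV[R]_p -> R) : open U -> (forall x, U x -> U' (F x)) ->
  smooth_mx_on U F -> smooth_on U' f -> smooth_on U (f \o F).
Proof. by move=> oU UU' sF sf k; apply: (Ck_comp oU UU') => // j; exact: sF. Qed.

Lemma smooth_mx_comp p q r U (U' : set 'rV[R]_p) (F : 'rV[R]_m -> 'rV[R]_p)
    (f : 'rV[R]_p -> 'M[R]_(q, r)) : open U -> (forall x, U x -> U' (F x)) ->
  smooth_mx_on U F -> smooth_mx_on U' f -> smooth_mx_on U (f \o F).
Proof. by move=> oU UU' sF sf i j; exact: (smooth_comp oU UU' sF (sf i j)). Qed.

Lemma smooth_mulmx p q r U (f : 'rV[R]_m -> 'M[R]_(p, q))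
    (g : 'rV[R]_m -> 'M[R]_(q, r)) : open U ->
  smooth_mx_on U f -> smooth_mx_on U g -> smooth_mx_on U (fun x => f x *m g x).
Proof.
move=> oU sf sg i j k.
have cS : Ck k U (fun x => \sum_l f x i l * g x l j).
  by apply: Ck_sum => // l _; apply: Ck_mul => //; [exact: sf|exact: sg].
by apply: (Ck_ext oU) cS => x _; rewrite mxE.
Qed.

Lemma smooth_scalemx p q U (a : 'rV[R]_m -> R) (f : 'rV[R]_m -> 'M[R]_(p, q)) :
  open U ->
  smooth_on U a -> smooth_mx_on U f -> smooth_mx_on U (fun x => a x *: f x).
Proof.
move=> oU sa sf i j k.
by apply: (Ck_ext oU) (Ck_mul oU (sa k) (sf i j k)) => x _; rewrite mxE.
Qed.

Lemma smooth_submx p q U (f g : 'rV[R]_m -> 'M[R]_(p, q)) : open U ->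
  smooth_mx_on U f -> smooth_mx_on U g -> smooth_mx_on U (fun x => f x - g x).
Proof.
move=> oU sf sg i j k.
by apply: (Ck_ext oU) (smooth_sub oU (sf i j) (sg i j) k) => x _; rewrite !mxE.
Qed.

Lemma smooth_trmx p q U (f : 'rV[R]_m -> 'M[R]_(p, q)) : open U ->
  smooth_mx_on U f -> smooth_mx_on U (fun x => (f x)^T).
Proof.
by move=> oU sf i j k; apply: (Ck_ext oU) (sf j i k) => x _; rewrite mxE.
Qed.

Lemma smooth_mx_cst p q U (A : 'M[R]_(p, q)) : smooth_mx_on U (fun=> A).
Proof. by move=> i j k; exact: Ck_cst. Qed.

Lemma smooth_det p U (f : 'rV[R]_m -> 'M[R]_p) : open U ->
  smooth_mx_on U f -> smooth_on U (fun x => \det (f x)).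
Proof.
move=> oU sf k; rewrite /determinant.
apply: Ck_sum => // s _; apply: Ck_mul => //; first exact: Ck_cst.
by apply: Ck_prod => // i _; exact: sf.
Qed.

(** Cramer's rule: the entries of the inverse are cofactors, polynomial in the entries of f, divided
    by the determinant. *)
Lemma smooth_invmx p U (f : 'rV[R]_m -> 'M[R]_p) : open U ->
  (forall x, U x -> f x \in unitmx) ->
  smooth_mx_on U f -> smooth_mx_on U (fun x => invmx (f x)).
Proof.
move=> oU fu sf i j k.
have cof : Ck k U (fun x => cofactor (f x) j i).
  apply: Ck_mul => //; first exact: Ck_cst.
  apply: smooth_det => // i' j' k'.
  by apply: (Ck_ext oU) (sf (lift j i') (lift i j') k') => x _; rewrite !mxE.
have cdet : Ck k U (fun x => (\det (f x))^-1).
  apply: Ck_inv => //; last exact: smooth_det.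
  by move=> x /fu; rewrite unitmxE unitfE.
by apply: (Ck_ext oU) (Ck_mul oU cdet cof) => x Ux; rewrite /invmx fu // !mxE.
Qed.

Lemma jacobianE p (F : 'rV[R]_m -> 'rV[R]_p) x a b : differentiable F x ->
  jacobian F x a b = partial a (fun y => F y 0 b) x.
Proof.
move=> dF; rewrite /partial -derive_entry // deriveEjacobian //.
by rewrite -rowE [RHS]mxE.
Qed.

Lemma jacobian_comp p q (F : 'rV[R]_m -> 'rV[R]_p) (G : 'rV[R]_p -> 'rV[R]_q) x :
  differentiable F x -> differentiable G (F x) ->
  jacobian (G \o F) x = jacobian F x *m jacobian G (F x).
Proof.
move=> dF dG; apply/row_matrixP => a; rewrite row_mul !rowE.
rewrite -(deriveEjacobian _ (differentiable_comp dF dG)) derive_comp //.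
by rewrite (deriveEjacobian _ dG) (deriveEjacobian _ dF).
Qed.

Lemma smooth_jacobian p U (F : 'rV[R]_m -> 'rV[R]_p) : open U ->
  smooth_mx_on U F -> smooth_mx_on U (jacobian F).
Proof.
move=> oU sF a b k; have [_ /(_ a)] := sF 0 b k.+1.
apply: (Ck_ext oU) => x Ux.
by rewrite jacobianE //; exact: smooth_mx_differentiable sF Ux.
Qed.

(** Both sides are the second derivative of F along v and w, so this is Schwarz's theorem for each
    component. It supplies the three symmetry hypotheses of [koszul_pullback]. *)
Lemma derive_jacobian_sym p U (F : 'rV[R]_m -> 'rV[R]_p) x v w : open U ->
  smooth_mx_on U F -> U x ->
  w *m 'D_v (jacobian F) x = v *m 'D_w (jacobian F) x.
Proof.
move=> oU sF Ux.
have dF y : U y -> differentiable F y := fun h => smooth_mx_differentiable sF h.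
have dJ y : U y -> differentiable (jacobian F) y.
  exact/smooth_mx_differentiable/smooth_jacobian.
have nU : nbhs x U by exact: open_nbhs_nbhs.
pose S a b c := partial a (partial b (fun y => F y 0 c)) x.
have Ssym a b c : S a b c = S b a c.
  have [_ p1] := sF 0 c 2%N; have [_ p2] := sF 0 c 3%N.
  apply: schwarz.
  - by apply: filterS nU => y Uy; apply: differentiable_entry; exact: dF.
  - by apply: filterS nU => y Uy; have [+ _] := p1 b; apply.
  - by apply: filterS nU => y Uy; have [+ _] := p1 a; apply.
  - by have [_ /(_ a) /= c2] := p1 b; exact: c2 x Ux.
  - by have [_ /(_ b) /= c2] := p1 a; exact: c2 x Ux.
have dpart b c : differentiable (partial b (fun y => F y 0 c)) x.
  by have [_ /(_ b)[+ _]] := sF 0 c 2%N; apply.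
have DJ u b c : ('D_u (jacobian F) x) b c = \sum_a u 0 a * S a b c.
  rewrite derive_entry; last exact: dJ.
  rewrite (@near_eq_derive _ _ _ _ (partial b (fun y => F y 0 c))); last first.
    by apply: filterS nU => y Uy; rewrite jacobianE //; exact: dF.
  rewrite deriveE // [X in 'd _ _ X]row_sum_delta linear_sum.
  by apply: eq_bigr => a _; rewrite linearZ /= -deriveE.
have DJsum (u t : 'rV[R]_m) c : (u *m 'D_t (jacobian F) x) 0 c =
    \sum_b \sum_a u 0 b * (t 0 a * S a b c).
  by rewrite mxE; apply: eq_bigr => b _; rewrite DJ mulr_sumr.
apply/rowP => c; apply: etrans (DJsum w v c) _.
apply: etrans (esym (DJsum v w c)); rewrite exchange_big /=.
apply: eq_bigr => a _; apply: eq_bigr => b _.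
by rewrite Ssym mulrCA.
Qed.

End SmoothMatrix.

(** * Covariant derivatives with lowered index *)

(* G applied to (nabla_v Y, z), for the Levi-Civita connection of G in
   coordinates, see [nabla_lowered]. *)
Definition lowered_nabla (R : realType) (m : nat) (G : 'rV[R]_m -> 'M[R]_m)
    (Y : 'rV[R]_m -> 'rV[R]_m) (x v z : 'rV[R]_m) : 'M[R]_1 :=
  'D_v Y x *m G x *m z^T
  + 2^-1 *: (Y x *m 'D_v G x *m z^T + v *m 'D_(Y x) G x *m z^T
             - v *m 'D_z G x *m (Y x)^T).

Lemma form_sym (R : realType) m (G : 'M[R]_m) (u v : 'rV[R]_m) :
  G^T = G -> u *m G *m v^T = v *m G *m u^T.
Proof.
move=> Gs; have tr11 (A : 'M[R]_1) : A^T = A.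
  by apply/matrixP => i j; rewrite mxE !ord1.
by rewrite -[LHS]tr11 !trmx_mul trmxK Gs mulmxA.
Qed.

(* Algebraic core of [lowered_nabla_pullback]: Sw, Su, Sz are the derivatives
   of the Jacobian matrix J in the directions w, u, z, and the three
   hypotheses on them are the symmetry of second derivatives. *)
Lemma koszul_pullback (R : realType) n m (G Dw Du Dz : 'M[R]_m)
    (J Sw Su Sz : 'M[R]_(n, m)) (u u' w z : 'rV[R]_n) :
  G^T = G -> u *m Sw = w *m Su -> z *m Sw = w *m Sz -> z *m Su = u *m Sz ->
  u' *m (J *m G *m J^T) *m z^T
  + 2^-1 *: (u *m (Sw *m G *m J^T + J *m Dw *m J^T + J *m G *m Sw^T) *m z^T
           + w *m (Su *m G *m J^T + J *m Du *m J^T + J *m G *m Su^T) *m z^T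
           - w *m (Sz *m G *m J^T + J *m Dz *m J^T + J *m G *m Sz^T) *m u^T)
  = (u' *m J + u *m Sw) *m G *m (z *m J)^T
  + 2^-1 *: (u *m J *m Dw *m (z *m J)^T + w *m J *m Du *m (z *m J)^T
             - w *m J *m Dz *m (u *m J)^T).
Proof.
move=> Gs uw zw zu.
have split3 (a b : 'rV[R]_n) (S : 'M[R]_(n, m)) (D : 'M[R]_m) :
    a *m (S *m G *m J^T + J *m D *m J^T + J *m G *m S^T) *m b^T =
    (a *m S) *m G *m (b *m J)^T + (a *m J) *m D *m (b *m J)^T
    + (a *m J) *m G *m (b *m S)^T.
  by rewrite !mulmxDr !mulmxDl !trmx_mul !mulmxA.
have e0 : u' *m (J *m G *m J^T) *m z^T = u' *m J *m G *m (z *m J)^T.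
  by rewrite trmx_mul !mulmxA.
rewrite e0 !split3 -uw -zw zu !mulmxDl.
rewrite (form_sym (u *m J) (z *m Sw) Gs).
move: (u' *m J *m G *m _) (u *m Sw *m G *m _) (u *m J *m Dw *m _)
  (w *m J *m Du *m _) (z *m Sw *m G *m _) (w *m J *m G *m _)
  (w *m J *m Dz *m _) => a b c d e f k.
by apply/matrixP => i j; rewrite !mxE; field.
Qed.

(** The product rule gives three terms for each derivative of [J G J^T], and [koszul_pullback] does
    the rest. The right-hand side follows the pattern of [lowered_nabla] for G, but is written out
    because V lives only along F, so that ['D_w V] is a derivative on the source. *)
Lemma lowered_nabla_pullback (R : realType) n m (U : set 'rV[R]_n)
    (F : 'rV[R]_n -> 'rV[R]_m) (G : 'rV[R]_m -> 'M[R]_m)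
    (h : 'rV[R]_n -> 'M[R]_n) (u : 'rV[R]_n -> 'rV[R]_n)
    (V : 'rV[R]_n -> 'rV[R]_m) (y w z : 'rV[R]_n) :
  open U -> U y -> smooth_mx_on U F -> differentiable G (F y) ->
  (G (F y))^T = G (F y) ->
  (forall x, U x -> h x = jacobian F x *m G (F x) *m (jacobian F x)^T) ->
  differentiable u y -> (forall x, U x -> V x = u x *m jacobian F x) ->
  lowered_nabla h u y w z =
  'D_w V y *m G (F y) *m (z *m jacobian F y)^T
  + 2^-1 *: (V y *m 'D_(w *m jacobian F y) G (F y) *m (z *m jacobian F y)^T
    + w *m jacobian F y *m 'D_(V y) G (F y) *m (z *m jacobian F y)^T
    - w *m jacobian F y *m 'D_(z *m jacobian F y) G (F y) *m (V y)^T).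
Proof.
move=> oU Uy sF dG Gs hE du VE.
have nU : nbhs y U by exact: open_nbhs_nbhs.
have dF : differentiable F y by exact: smooth_mx_differentiable sF Uy.
have dJ : differentiable (jacobian F) y.
  by apply: smooth_mx_differentiable Uy; exact: smooth_jacobian.
have dGF : differentiable (G \o F) y by exact: differentiable_comp.
have dJT : differentiable (fun x => (jacobian F x)^T) y.
  exact: differentiable_trmx.
have dJG := differentiable_mulmx dJ dGF.
have Dh t : 'D_t h y =
    'D_t (jacobian F) y *m G (F y) *m (jacobian F y)^T
    + jacobian F y *m 'D_(t *m jacobian F y) G (F y) *m (jacobian F y)^T
    + jacobian F y *m G (F y) *m ('D_t (jacobian F) y)^T.
  rewrite (@near_eq_derive _ _ _ _
    (fun x => (jacobian F x *m (G \o F) x) *m (jacobian F x)^T)).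
    rewrite (derive_mulmx t dJG dJT) (derive_trmx t dJ) (derive_mulmx t dJ dGF).
    by rewrite (derive_comp t dF dG) (deriveEjacobian t dF) mulmxDl.
  by apply: filterS nU => x /hE.
have DV : 'D_w V y = 'D_w u y *m jacobian F y + u y *m 'D_w (jacobian F) y.
  rewrite (@near_eq_derive _ _ _ _ (fun x => u x *m jacobian F x)).
    exact: derive_mulmx.
  by apply: filterS nU => x /VE.
rewrite /lowered_nabla (Dh w) (Dh (u y)) (Dh z) DV (hE y Uy) (VE y Uy).
have sym v t := derive_jacobian_sym v t oU sF Uy.
exact: koszul_pullback Gs (sym w (u y)) (sym w z) (sym (u y) z).
Qed.

(** With [V = Y - f X] along F, the Leibniz rule and bilinearity split the pulled back expression
    into the one for Y minus f times the one for X. The only other term is ['D_w f] times the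
    pairing of X with the tangent vector [z J], which is zero since X is normal to the image of
    F. *)
Lemma lowered_nabla_tangent_part (R : realType) n m (U : set 'rV[R]_n)
    (F : 'rV[R]_n -> 'rV[R]_m) (G : 'rV[R]_m -> 'M[R]_m)
    (h : 'rV[R]_n -> 'M[R]_n) (u : 'rV[R]_n -> 'rV[R]_n)
    (X Y : 'rV[R]_m -> 'rV[R]_m) (f : 'rV[R]_n -> R) (a b : R)
    (y w z : 'rV[R]_n) :
  open U -> U y -> smooth_mx_on U F -> differentiable G (F y) ->
  (G (F y))^T = G (F y) ->
  (forall x, U x -> h x = jacobian F x *m G (F x) *m (jacobian F x)^T) ->
  differentiable u y -> differentiable f y ->
  differentiable X (F y) -> differentiable Y (F y) ->
  (forall x, U x -> u x *m jacobian F x = Y (F x) - f x *: X (F x)) ->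
  jacobian F y *m G (F y) *m (X (F y))^T = 0 ->
  (forall t s, lowered_nabla G X (F y) t s = a *: (t *m G (F y) *m s^T)) ->
  (forall t s, lowered_nabla G Y (F y) t s = b *: (t *m G (F y) *m s^T)) ->
  lowered_nabla h u y w z = (b - a * f y) *: (w *m h y *m z^T).
Proof.
move=> oU Uy sF dG Gs hE du df dX dY uE JX conX conY.
have dF : differentiable F y by exact: smooth_mx_differentiable sF Uy.
pose V x := Y (F x) - f x *: X (F x).
rewrite (@lowered_nabla_pullback _ _ _ U F G h u V y w z) //; last first.
  by move=> x /uE.
set J := jacobian F y; rewrite (hE y Uy) -/J.
have dXF : differentiable (X \o F) y by exact: differentiable_comp.
have dYF : differentiable (Y \o F) y by exact: differentiable_comp.
have DV : 'D_w V y = 'D_(w *m J) Y (F y) -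
    ('D_w f y *: X (F y) + f y *: 'D_(w *m J) X (F y)).
  have dfX := differentiableZfun df dXF.
  rewrite (@deriveB _ _ _ (Y \o F) (fun x => f x *: (X \o F) x));
    [|exact: diff_derivable..].
  rewrite (deriveZfun w df dXF) (derive_comp w dF dX) (derive_comp w dF dY).
  by rewrite (deriveEjacobian w dF).
(* [lowered_nabla] also differentiates G in the direction of the field itself, so the derivative has
   to be split linearly in its direction. *)
have DG := derive_linear dG.
have DGV : 'D_(V y) G (F y) = 'D_(Y (F y)) G (F y) - f y *: 'D_(X (F y)) G (F y).
  have -> : V y = - f y *: X (F y) + Y (F y) by rewrite scaleNr addrC.
  by apply: etrans (DG _ _ _) _; rewrite scaleNr addrC.
have := conY (w *m J) (z *m J); have := conX (w *m J) (z *m J).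
rewrite /lowered_nabla DV DGV /V.
have XJ : X (F y) *m G (F y) *m (z *m J)^T = 0.
  by rewrite (form_sym _ _ Gs) -mulmxA -mulmxA (mulmxA J) JX mulmx0.
have -> : w *m (J *m G (F y) *m J^T) *m z^T = w *m J *m G (F y) *m (z *m J)^T.
  by rewrite trmx_mul !mulmxA.
clear - XJ.
move: ('D_(w *m J) Y (F y)) ('D_(w *m J) X (F y)) ('D_(Y (F y)) G (F y))
  ('D_(X (F y)) G (F y)) ('D_(w *m J) G (F y)) ('D_(z *m J) G (F y))
  ('D_w f y) (f y) => DY DX GY GX Gw Gz Df fy.
move: XJ; move: (z *m J) (w *m J) (G (F y)) (X (F y)) (Y (F y)).
move=> z' w' g' x' y' XJ.
have trB (A B : 'rV[R]_m) : (A - fy *: B)^T = A^T - fy *: B^T.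
  by apply/matrixP => i j; rewrite !mxE.
rewrite trB !(mulmxBl, mulmxBr, mulmxDl) -!(scalemxAl, scalemxAr) XJ.
move=> Ex Ey; rewrite scalerBl mulrC -scalerA -Ex -Ey {Ex Ey}.
move: (DX *m _ *m _) (DY *m _ *m _) (x' *m Gw *m _) (y' *m Gw *m _)
  (w' *m GX *m _) (w' *m GY *m _) (w' *m Gz *m x'^T) (w' *m Gz *m y'^T).
by move=> ? ? ? ? ? ? ? ?; apply/matrixP => i j; rewrite !mxE; field.
Qed.

(** * Charts *)

Lemma jacobian_near_eq (R : realType) m p (f g : 'rV[R]_m -> 'rV[R]_p) x :
  {near x, f =1 g} -> differentiable f x -> jacobian f x = jacobian g x.
Proof.
move=> fg df; have dg := near_eq_differentiable fg df.
apply/matrixP => a b; apply: etrans (jacobianE a b df) _.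
apply: etrans (esym (jacobianE a b dg)); apply: near_eq_derive.
by apply: filterS fg => y ->.
Qed.

Lemma jacobian_id (R : realType) m (x : 'rV[R]_m) : jacobian id x = 1%:M.
Proof.
apply/row_matrixP => a; rewrite !rowE mulmx1.
apply: etrans (derive_id _ _); apply/esym/deriveEjacobian.
exact: (@ex_diff _ _ _ _ _ _ _ (is_diff_id x)).
Qed.

Section Charts.
Variables (R : realType) (m : nat) (M : manifold R m).
Implicit Types (i j k : chart_index M) (p : M) (x : 'rV[R]_m).

Lemma cod_chart i p : dom i p -> cod i (chart i p).
Proof. by move=> ip; exists p. Qed.

Lemma dom_param i x : cod i x -> dom i (param i x).
Proof. by move=> [p ip <-]; rewrite chartK. Qed.

Lemma paramK i x : cod i x -> chart i (param i x) = x.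
Proof. by move=> [p ip <-]; rewrite chartK. Qed.

Lemma nbhs_cod i x : cod i x -> nbhs x (cod i).
Proof. by move=> ix; apply: open_nbhs_nbhs; split=> //; exact: open_cod. Qed.

Lemma chart_imageE i (A : set M) :
  chart i @` (dom i `&` A) = cod i `&` (param i @^-1` A).
Proof.
apply/seteqP; split=> x.
  by move=> [p [ip Ap] <-]; split; [exact: cod_chart|rewrite /= chartK].
by move=> [ix Ax]; exists (param i x); [split=> //; exact: dom_param|exact: paramK].
Qed.

Lemma open_chart_image i (A : set M) : open A -> open (chart i @` (dom i `&` A)).
Proof.
move=> oA; rewrite chart_imageE openE => x [ix Ax].
apply: filterI; first exact: nbhs_cod.
have nA : nbhs (param i x) A by exact: open_nbhs_nbhs.
exact: (param_continuous ix nA).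
Qed.
End Charts.

(** For the identity map this is [change], and in the charts chosen by [chart_at] it is
    [tangent_map], so the transformation rules of both come from one chain rule, [jac_comp]. *)
Definition jac (R : realType) (n m : nat) (N : manifold R n) (M : manifold R m)
    (F : N -> M) (i : chart_index N) (j : chart_index M) (q : N) : 'M[R]_(n, m) :=
  jacobian (chart j \o F \o param i) (chart i q).

Lemma smooth_map_id (R : realType) m (M : manifold R m) : smooth_map (@id M).
Proof.
by split=> [p|i j]; [exact: cvg_id|exact: (@transition_smooth _ _ M i j)].
Qed.

Section Maps.
Variables (R : realType) (n m : nat) (N : manifold R n) (M : manifold R m).
Variables (F : N -> M) (smF : smooth_map F).

Lemma open_map_dom (i : chart_index N) (j : chart_index M) :
  open (chart i @` (dom i `&` (F @^-1` dom j))).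
Proof.
apply: open_chart_image; apply: open_comp; last exact: open_dom.
by move=> q _; case: smF => cF _; exact: cF.
Qed.

Lemma differentiable_map (i : chart_index N) (j : chart_index M) q :
  dom i q -> dom j (F q) ->
  differentiable (chart j \o F \o param i) (chart i q).
Proof.
move=> iq jFq; case: smF => _ /(_ i j) /smooth_mx_differentiable; apply.
by exists q.
Qed.

(** The chain rule in coordinates. The composite of the two coordinate expressions contains
    [param j \o chart j], which is the identity on [dom j]; hence it agrees with the expression of
    [G \o F] near q, and [jacobian_near_eq] concludes. *)
Lemma jac_comp l (P : manifold R l) (G : M -> P) (i : chart_index N)
    (j : chart_index M) (k : chart_index P) q :
  smooth_map G -> dom i q -> dom j (F q) -> dom k (G (F q)) ->
  jac F i j q *m jac G j k (F q) = jac (G \o F) i k q.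
Proof.
move=> smG iq jFq kGq; rewrite /jac.
have dF := differentiable_map iq jFq.
have e : (chart j \o F \o param i) (chart i q) = chart j (F q).
  by rewrite /= chartK.
have dG : differentiable (chart k \o G \o param j) (chart j (F q)).
  case: smG => _ /(_ j k) /smooth_mx_differentiable; apply.
  by exists (F q).
rewrite -e in dG *; apply: etrans (esym (jacobian_comp dF dG)) _.
apply: jacobian_near_eq; last exact: differentiable_comp.
have nq : nbhs (chart i q) (chart i @` (dom i `&` (F @^-1` dom j))).
  by apply: open_nbhs_nbhs; split; [exact: open_map_dom|exists q].
by apply: filterS nq => _ [q' [iq' jFq'] <-] /=; rewrite !chartK.
Qed.
End Maps.

Section Changes.
Variables (R : realType) (m : nat) (M : manifold R m).
Implicit Types (i j k : chart_index M) (p : M).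

Lemma change_mul i j k p : dom i p -> dom j p -> dom k p ->
  change i j p *m change j k p = change i k p.
Proof.
exact: (@jac_comp _ _ _ M M id (smooth_map_id M) _ M id i j k p (smooth_map_id M)).
Qed.

Lemma change_id i p : dom i p -> change i i p = 1%:M.
Proof.
move=> ip; rewrite -(jacobian_id (chart i p)) /change.
apply: jacobian_near_eq.
  have nc := nbhs_cod (cod_chart ip).
  by apply: filterS nc => x ix /=; rewrite paramK.
exact: (differentiable_map (smooth_map_id M)).
Qed.

Lemma change_unit i j p : dom i p -> dom j p -> change i j p \in unitmx.
Proof.
move=> ip jp.
have [u _] := mulmx1_unit (etrans (change_mul ip jp ip) (change_id ip)).
exact: u.
Qed.

(** The base point is read in the target chart j because [field_in] is a function of the target
    coordinates; hence the precomposition with the transition from j to i. *)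
Lemma smooth_change i j :
  smooth_mx_on (chart j @` (dom j `&` dom i)) (change i j \o param j).
Proof.
have oij : open (chart i @` (dom i `&` dom j)).
  by apply: open_chart_image; exact: open_dom.
have oji : open (chart j @` (dom j `&` dom i)).
  by apply: open_chart_image; exact: open_dom.
have sJ := smooth_jacobian oij (@transition_smooth _ _ M i j).
apply: (smooth_mx_comp oji _ (@transition_smooth _ _ M j i) sJ).
by move=> _ [p [jp ip] <-]; exists p => //=; rewrite chartK.
Qed.

End Changes.

Section MapChanges.
Variables (R : realType) (n m : nat) (N : manifold R n) (M : manifold R m).
Variables (F : N -> M) (smF : smooth_map F).

Lemma change_jac (i i' : chart_index N) (j : chart_index M) q :
  dom i q -> dom i' q -> dom j (F q) ->
  change i' i q *m jac F i j q = jac F i' j q.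
Proof.
move=> iq iq' jq.
exact: (@jac_comp _ _ _ N N id (smooth_map_id N) _ M F i' i j q smF).
Qed.

Lemma jac_change (i : chart_index N) (j j' : chart_index M) q :
  dom i q -> dom j (F q) -> dom j' (F q) ->
  jac F i j q *m change j j' (F q) = jac F i j' q.
Proof.
move=> iq jq jq'.
exact: (@jac_comp _ _ _ N M F smF _ M id i j j' q (smooth_map_id M)).
Qed.

End MapChanges.

(** * Bump functions and extension of tangent vectors *)

Section FlatFunction.
Variable R : realType.

(* [flat j] is the j-th derivative of exp(-1/t), extended by 0 to t <= 0; on
   t > 0 it is P_j(1/t) exp(-1/t) with P_(j+1) = X^2 (P_j - P_j'). *)
Fixpoint flat_poly (j : nat) : {poly R} :=
  if j is j'.+1 then 'X^2 * (flat_poly j' - (flat_poly j')^`()) else 1.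

Definition flat (j : nat) (t : R) : R :=
  if 0 < t then (flat_poly j).[t^-1] * expR (- t^-1) else 0.

Lemma exprn_le_expR (s : R) k : 0 <= s -> s ^+ k <= k`!%:R * expR s.
Proof.
move=> s0; case: k => [|k].
  by rewrite expr0 mul1r (le_trans _ (expR_ge1Dx s)) // lerDl.
rewrite mulrC -ler_pdivrMr; last by rewrite ltr0n fact_gt0.
by apply: le_trans (expR_ge1Dxn k s0); rewrite lerDr.
Qed.

Lemma poly_le_expR (p : {poly R}) :
  exists C : R, forall s : R, 0 <= s -> `|p.[s]| <= C * expR s.
Proof.
exists (\sum_(i < size p) `|p`_i| * i`!%:R) => s s0.
rewrite horner_coef (le_trans (ler_norm_sum _ _ _)) // mulr_suml.
apply: ler_sum => i _; rewrite normrM -mulrA ler_wpM2l //.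
by rewrite ger0_norm ?exprn_ge0 //; exact: exprn_le_expR.
Qed.

(** With [s = 1/t], the polynomial [s^2 P_j(s)] is dominated by [C exp(s)], which is the bound
    sought. The quadratic rate yields the derivative 0 at the origin in [is_derive_flat]. *)
Lemma flat_bound j : exists C : R, forall t : R, `|flat j t| <= C * t ^+ 2.
Proof.
have [C Cp] := poly_le_expR ('X^2 * flat_poly j).
have C0 : 0 <= C.
  have := Cp 0 (lexx _); rewrite expR0 mulr1; exact: le_trans.
exists C => t; rewrite /flat; case: ifPn => [t0|_]; last first.
  by rewrite normr0 mulr_ge0 // sqr_ge0.
have tV0 : 0 <= t^-1 by rewrite invr_ge0 ltW.
have := Cp _ tV0; rewrite hornerM hornerXn normrM (ger0_norm (exprn_ge0 _ tV0)).
rewrite normrM (ger0_norm (expR_ge0 _)) expRN => h.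
rewrite ler_pdivrMr ?expR_gt0 //. rewrite (mulrAC C).
have t2 : t^-1 ^+ 2 * t ^+ 2 = 1 by rewrite -exprMn mulVf ?expr1n // gt_eqF.
rewrite -[leLHS]mul1r -t2 (mulrAC (t^-1 ^+ 2)) ler_wpM2r //; exact: sqr_ge0.
Qed.

Lemma is_derive_flat j (t : R) : is_derive t 1 (flat j) (flat j.+1 t).
Proof.
have [t0|t0|->] := ltgtP t 0.
- have -> : flat j.+1 t = 0 by rewrite /flat ltNge (ltW t0).
  have d0 : is_derive t 1 (cst 0 : R -> R) 0 by exact: is_derive_cst.
  apply: near_eq_is_derive d0.
  near=> s; rewrite /flat ltNge (_ : s <= 0) //.
  by apply: ltW; near: s; exact: lt_nbhsl.
- have tn0 : t != 0 by rewrite gt_eqF.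
  pose inv := fun s : R => s^-1.
  have dinv : is_derive t 1 inv (- t ^- 2).
    have := @is_deriveV R id t 1 1 tn0 (is_derive_id _ _).
    by rewrite [_ *: _]mulr1.
  have dP : is_derive t 1 (horner (flat_poly j) \o inv)
      ((flat_poly j)^`().[t^-1] * (- t ^- 2)).
    exact: (is_derive1_comp (is_derive_poly _ _) dinv).
  have dE : is_derive t 1 (expR \o (fun s => - inv s))
      (t ^- 2 * expR (- t^-1)).
    have dN : is_derive t 1 (fun s => - inv s) (t ^- 2).
      by have := is_deriveN dinv; rewrite opprK.
    by have := is_derive1_comp (is_derive_expR _) dN; rewrite mulrC.
  have dPE : is_derive t 1
      ((horner (flat_poly j) \o inv) * (expR \o (fun s => - inv s)))
      (flat j.+1 t).
    apply: is_derive_eq; rewrite /flat t0 /= hornerM hornerXn hornerD hornerN.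
    rewrite /inv exprVn /GRing.scale /=; ring.
  apply: near_eq_is_derive dPE.
  near=> s; rewrite /flat (_ : 0 < s) //.
  by near: s; exact: lt_nbhsr.
(* At the origin [flat_bound] bounds the difference quotient by [C |h|]. *)
- have -> : flat j.+1 0 = 0 by rewrite /flat ltxx.
  have [C Cb] := flat_bound j.
  suff lim0 : h^-1 *: (flat j (h *: 1 + 0) - flat j 0) @[h --> 0^'] --> (0 : R).
    apply: DeriveDef; first by apply/cvg_ex; exists 0.
    exact: cvg_lim lim0.
  apply/cvgrPdist_le => e e0; near=> h.
  have hn : h != 0 by near: h; exact: nbhs_dnbhs_neq.
  (* The 1 keeps the denominator positive when C is 0. *)
  have hle : `|h| < e / (`|C| + 1).
    by near: h; apply: dnbhs0_lt; rewrite divr_gt0 // ltr_wpDl.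
  rewrite sub0r normrN [h *: 1]mulr1 addr0 /(flat j 0) ltxx subr0 normrZ normfV.
  rewrite mulrC ler_pdivrMr ?normr_gt0 // (le_trans (Cb h)) //.
  rewrite -(real_normK (num_real h)) expr2 mulrA ler_wpM2r //.
  rewrite (le_trans (ler_norm _)) // normrM normr_id.
  have := ltW hle; rewrite ler_pdivlMr ?ltr_wpDl // => /(le_trans _); apply.
  by rewrite mulrC ler_wpM2l // lerDl.
Unshelve. all: by end_near. Qed.

End FlatFunction.

Section Bump.
Variables (R : realType) (m : nat).

Lemma smooth_coord U (k : 'I_m) : smooth_on U (fun x : 'rV[R]_m => x 0 k).
Proof.
case=> [|l]; first by move=> x _; exact: coord_continuous.
split=> [x _|a]; first exact: differentiable_coord.
have -> : partial a (fun x : 'rV[R]_m => x 0 k) = cst ((1%:M : 'M[R]_m) a k).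
  apply/funext => x; have did : differentiable (@id 'rV[R]_m) x.
    exact: (@ex_diff _ _ _ _ _ _ _ (is_diff_id x)).
  by apply: etrans (esym (jacobianE a k did)) _; rewrite jacobian_id.
exact: Ck_cst.
Qed.

(** The norm on row vectors is the maximum norm, so balls are cubes, and a product over the
    coordinates of one-variable bumps vanishes outside such a ball. *)
Definition cube_bump (c : 'rV[R]_m) (r : R) (x : 'rV[R]_m) : R :=
  \prod_(k < m) flat 0 (r ^+ 2 - (x 0 k - c 0 k) ^+ 2).

Lemma cube_bump_center c r : 0 < r -> cube_bump c r c != 0.
Proof.
move=> r0; apply/prodf_neq0 => k _.
rewrite subrr expr0n subr0 /flat exprn_gt0 // mulf_neq0 ?gt_eqF ?expR_gt0 //.
by rewrite hornerC.
Qed.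

Lemma cube_bump_support c r x : 0 < r -> cube_bump c r x != 0 -> `|x - c| <= r.
Proof.
move=> r0 /prodf_neq0 bx.
rewrite [leLHS]/Num.norm /= mx_normrE; apply: bigmax_le; first exact: ltW.
move=> [i k] _ /=; rewrite ord1 !mxE; have := bx k isT.
rewrite /flat; case: ifPn; last by rewrite eqxx.
rewrite subr_gt0 => h _.
by rewrite -ler_sqr ?nnegrE ?normr_ge0 ?ltW // real_normK ?num_real.
Qed.

Lemma smooth_cube_bump c r U : open U -> smooth_on U (cube_bump c r).
Proof.
move=> oU k; apply: Ck_prod => // i _.
apply: (@Ck_scalar_comp _ _ _ U (fun x => r ^+ 2 - (x 0 i - c 0 i) ^+ 2)
  (@flat R) 0 oU); first by move=> j x _; exact: is_derive_flat.
have cx : Ck k U (fun x : 'rV[R]_m => x 0 i - c 0 i).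
  exact: (Ck_add oU (smooth_coord U i k) (Ck_cst k U (- c 0 i))).
apply: (Ck_ext oU _ (Ck_add oU (Ck_cst k U (r ^+ 2))
  (Ck_mul oU (Ck_cst k U (-1)) (Ck_mul oU cx cx)))) => x _.
by rewrite mulN1r expr2.
Qed.

End Bump.

Section VectorExtension.
Variables (R : realType) (m : nat) (M : manifold R m).

Lemma field_in_chart (X : M -> 'rV[R]_m) (i : chart_index M) p : dom i p ->
  field_in X i (chart i p) = X p *m change (chart_at p) i p.
Proof. by move=> ip; rewrite /field_in chartK. Qed.

(** Components near p in a single chart i suffice: passing to another chart j multiplies them by
    [change i j], which is smooth in the coordinates of j by [smooth_change]. *)
Lemma smooth_field_local (X : M -> 'rV[R]_m) :
  (forall p, exists A : set M, exists i : chart_index M,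
     exists Y : 'rV[R]_m -> 'rV[R]_m, [/\ open A, A p, A `<=` dom i,
     smooth_mx_on (chart i @` (dom i `&` A)) Y &
     forall q, A q -> X q *m change (chart_at q) i q = Y (chart i q)]) ->
  smooth_field X.
Proof.
move=> loc j; apply: smooth_mx_near => _ [p jp <-].
have [A [i [Y [oA Ap Ai sY XY]]]] := loc p.
have oAji : open (dom i `&` A) by apply: openI => //; exact: open_dom.
have oW := open_chart_image (i := j) oAji.
pose g := fun x => (Y \o (chart i \o param j)) x *m (change i j \o param j) x.
exists (chart j @` (dom j `&` (dom i `&` A))), g; split.
- exact: oW.
- by exists p; split=> //; split; [exact: Ai|].
- apply: smooth_mulmx; first exact: oW.
    apply: (smooth_mx_comp oW _ _ sY).
      by move=> _ [q [jq [iq Aq]] <-]; exists q => //=; rewrite chartK.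
    apply: smooth_mx_sub (@transition_smooth _ _ M j i).
    by move=> _ [q [jq [iq Aq]] <-]; exists q.
  apply: smooth_mx_sub (smooth_change i j).
  by move=> _ [q [jq [iq Aq]] <-]; exists q.
- move=> _ [q [jq [iq Aq]] <-]; rewrite (field_in_chart _ jq) /g /comp (chartK jq).
  have cq := dom_chart_at q.
  by rewrite -(XY q Aq) -mulmxA (change_mul cq iq jq).
Qed.

(** The field with constant components v in the chart at p is multiplied by a bump function and
    extended by 0. It vanishes off K, which is compact, hence closed since M is Hausdorff; the
    complement of K is then an open set that contains all points outside the chart domain, where
    smoothness is clear. *)
Lemma tangent_vector_extension (p : M) (v : 'rV[R]_m) :
  exists2 X : M -> 'rV[R]_m, smooth_field X & X p = v.
Proof.
pose i := chart_at p; pose c := chart i p.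
have ip : dom i p := dom_chart_at p.
have /nbhs_ballP[r0 /= r00 ballr0] := nbhs_cod (cod_chart ip).
(* Halving the radius puts the closed cube B, and not only an open one, inside [cod i]. *)
pose r := r0 / 2; have rgt0 : 0 < r by rewrite divr_gt0.
pose B := [set x : 'rV[R]_m | `|x - c| <= r].
have Bcod : B `<=` cod i.
  move=> x Bx; apply: ballr0; rewrite -ball_normE /= distrC.
  by apply: le_lt_trans Bx _; rewrite ltr_pdivrMr // ltr_pMr // ltr1n.
have compB : compact B.
  apply: bounded_closed_compact.
    exists (r + `|c|); split=> [|x rx y By]; first exact: num_real.
    apply: le_trans (ltW rx); rewrite -(subrK c y).
    by apply: le_trans (ler_normD _ _) _; rewrite lerD2r.
  have -> : B = closed_ball_ (fun x => `|x|) c r.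
    by apply/seteqP; split=> x; rewrite /B /closed_ball_ /= distrC.
  exact: closed_closed_ball_.
pose K := param i @` B.
have closedK : closed K.
  apply: compact_closed; first exact: hausdorff_axiom.
  apply: continuous_compact compB.
  by apply: continuous_in_subspaceT => x /[!inE] /Bcod; exact: param_continuous.
(* Normalized to the value 1 at the centre, so that [X p = v]. *)
pose b x := cube_bump c r x / cube_bump c r c.
pose X q := if pselect (dom i q) then
  b (chart i q) *: (v *m change i (chart_at q) q) else 0.
have XE q : dom i q -> X q = b (chart i q) *: (v *m change i (chart_at q) q).
  by move=> iq; rewrite /X; case: pselect.
have XN q : ~ dom i q -> X q = 0 by move=> iq; rewrite /X; case: pselect.
exists X; last first.
  rewrite (XE p ip) (change_id ip) mulmx1 /b.
  by rewrite divff ?scale1r //; exact: cube_bump_center.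
have smb U : open U -> smooth_on U b.
  by move=> oU k; apply: (Ck_mul oU (smooth_cube_bump c r oU k)); exact: Ck_cst.
apply: smooth_field_local => q; have [iq|niq] := pselect (dom i q).
  exists (dom i), i, (fun x => b x *: v); split.
  - exact: open_dom.
  - exact: iq.
  - by [].
  - have oW : open (chart i @` (dom i `&` dom i)).
      by apply: open_chart_image; exact: open_dom.
    by apply: (smooth_scalemx oW (smb _ oW)); exact: smooth_mx_cst.
  - move=> q' iq'; rewrite (XE q' iq') -scalemxAl -mulmxA (change_mul iq' (dom_chart_at q') iq').
    by rewrite (change_id iq') mulmx1.
have qK : ~ K q by move=> [x /Bcod ix xq]; apply: niq; rewrite -xq; exact: dom_param.
exists (dom (chart_at q) `&` ~` K), (chart_at q), (fun=> 0); split.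
- by apply: openI; [exact: open_dom|exact: closed_openC].
- by split=> //; exact: dom_chart_at.
- by move=> q' [].
- exact: smooth_mx_cst.
- move=> q' [_ nKq']; have [iq'|/XN ->] := pselect (dom i q'); last by rewrite mul0mx.
  rewrite (XE q' iq'); have -> : b (chart i q') = 0; last by rewrite scale0r mul0mx.
  apply/eqP; rewrite mulf_eq0; apply/orP; left; apply: contra_notT nKq'.
  move=> /(cube_bump_support rgt0) Bq'.
  by exists (chart i q'); rewrite ?chartK.
Qed.

End VectorExtension.

(** * The Levi-Civita connection in charts *)

(** Pairing with G cancels the inverse metric in the Christoffel symbols and leaves Koszul's formula
    in coordinates. When [dg] holds the partial derivatives of the metric, [D w] is its derivative
    in the direction w. *)
Lemma christoffel_lower (R : realType) m (G : 'M[R]_m)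
    (dg : 'I_m -> 'I_m -> 'I_m -> R) (v y z : 'rV[R]_m) :
  let D (w : 'rV[R]_m) := \matrix_(d, e) \sum_c w 0 c * dg c d e in
  G \in unitmx -> G^T = G ->
  (\row_k \sum_a \sum_b
     2^-1 * (\sum_l invmx G k l * (dg a b l + dg b a l - dg l a b))
       * v 0 a * y 0 b) *m G *m z^T =
  2^-1 *: (y *m D v *m z^T + v *m D y *m z^T - v *m D z *m y^T).
Proof.
move=> D uG Gs.
(* Twice the Christoffel symbols of the first kind, contracted with v and y. *)
pose C : 'rV[R]_m :=
  \row_l \sum_a \sum_b (dg a b l + dg b a l - dg l a b) * v 0 a * y 0 b.
have -> : (\row_k \sum_a \sum_b
     2^-1 * (\sum_l invmx G k l * (dg a b l + dg b a l - dg l a b))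
       * v 0 a * y 0 b) = 2^-1 *: (C *m invmx G).
  apply/rowP => k; rewrite !mxE mulr_sumr.
  have -> : \sum_i 2^-1 * (C 0 i * invmx G i k) =
     \sum_i \sum_a \sum_b 2^-1 * (invmx G k i *
       (dg a b i + dg b a i - dg i a b)) * v 0 a * y 0 b.
    apply: eq_bigr => l _; rewrite mxE.
    have -> : invmx G l k = invmx G k l by rewrite -[in RHS]Gs -trmx_inv mxE.
    rewrite mulr_suml mulr_sumr; apply: eq_bigr => a _.
    rewrite mulr_suml mulr_sumr; apply: eq_bigr => b _; ring.
  rewrite [RHS]exchange_big /=; apply: eq_bigr => a _.
  rewrite [RHS]exchange_big /=; apply: eq_bigr => b _.
  by rewrite mulr_sumr !mulr_suml.
rewrite -scalemxAl mulmxKV // -scalemxAl; congr (_ *: _).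
have tri (a w b : 'rV[R]_m) : (a *m D w *m b^T) 0 0 =
    \sum_e \sum_d \sum_c dg c d e * a 0 d * w 0 c * b 0 e.
  rewrite mxE; apply: eq_bigr => e _; rewrite !mxE mulr_suml.
  apply: eq_bigr => d _; rewrite !mxE mulr_sumr mulr_suml.
  by apply: eq_bigr => c _; ring.
have entry (A1 A2 A3 : 'M[R]_1) : (A1 + A2 - A3) 0 0 = A1 0 0 + A2 0 0 - A3 0 0.
  by rewrite !mxE.
apply/matrixP => i j; rewrite !ord1 entry !tri.
(* The triple sums are put in the common order l, a, b, the indices of z, v and y; the term with
   [D y] has it already. *)
have -> : \sum_e \sum_d \sum_c dg c d e * v 0 d * z 0 c * y 0 e =
   \sum_l \sum_a \sum_b dg l a b * v 0 a * z 0 l * y 0 b.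
  rewrite exchange_big /= [RHS]exchange_big /=; apply: eq_bigr => d _.
  by rewrite exchange_big.
have -> : \sum_e \sum_d \sum_c dg c d e * y 0 d * v 0 c * z 0 e =
   \sum_l \sum_a \sum_b dg a b l * y 0 b * v 0 a * z 0 l.
  by apply: eq_bigr => l _; rewrite exchange_big.
rewrite mxE -sumrN -!big_split /=; apply: eq_bigr => l _.
rewrite !mxE mulr_suml -sumrN -!big_split /=; apply: eq_bigr => a _.
rewrite mulr_suml -sumrN -!big_split /=; apply: eq_bigr => b _; ring.
Qed.

Lemma derive_sum_partial (R : realType) m p q (f : 'rV[R]_m -> 'M[R]_(p, q)) x v i j :
  differentiable f x ->
  ('D_v f x) i j = \sum_c v 0 c * partial c (fun y => f y i j) x.
Proof.
move=> df; have dfe := differentiable_entry i j df.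
rewrite (derive_entry v i j df) deriveE // [X in 'd _ _ X]row_sum_delta linear_sum.
by apply: eq_bigr => c _; rewrite linearZ /= -deriveE.
Qed.

Lemma field_in_center (R : realType) m (M : manifold R m) (X : M -> 'rV[R]_m) p :
  field_in X (chart_at p) (chart (chart_at p) p) = X p.
Proof.
have cp := dom_chart_at p.
by rewrite (field_in_chart _ cp) (change_id cp) mulmx1.
Qed.

Lemma form_in_chart (R : realType) m (M : manifold R m) (g : M -> 'M[R]_m)
    (i : chart_index M) p : dom i p ->
  form_in g i (chart i p) =
    change i (chart_at p) p *m g p *m (change i (chart_at p) p)^T.
Proof. by move=> ip; rewrite /form_in chartK. Qed.

Lemma form_in_center (R : realType) m (M : manifold R m) (g : M -> 'M[R]_m) p :
  form_in g (chart_at p) (chart (chart_at p) p) = g p.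
Proof.
have cp := dom_chart_at p.
by rewrite (form_in_chart _ cp) (change_id cp) mul1mx trmx1 mulmx1.
Qed.

(** The connection is computed in the chart chosen at p, whose change of coordinates to itself is
    the identity at p. So [Y p] and [g p] are the components in that chart, and [christoffel_lower]
    applies. *)
Lemma nabla_lowered (R : realType) m (M : manifold R m) (g : M -> 'M[R]_m)
    (X Y : M -> 'rV[R]_m) p z :
  let i := chart_at p in let x := chart i p in
  differentiable (form_in g i) x -> differentiable (field_in Y i) x ->
  g p \in unitmx -> (g p)^T = g p ->
  nabla g X Y p *m g p *m z^T = lowered_nabla (form_in g i) (field_in Y i) x (X p) z.
Proof.
move=> i x dg dY ug sg.
have gx : form_in g i x = g p by exact: form_in_center.
have Yx : field_in Y i x = Y p by exact: field_in_center.
pose dG c d e := partial c (fun y => form_in g i y d e) x.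
have DG w : 'D_w (form_in g i) x = \matrix_(d, e) \sum_c w 0 c * dG c d e.
  by apply/matrixP => d e; rewrite [RHS]mxE; exact: derive_sum_partial.
have -> : nabla g X Y p = 'D_(X p) (field_in Y i) x +
  \row_k \sum_a \sum_b
     2^-1 * (\sum_l invmx (g p) k l * (dG a b l + dG b a l - dG l a b))
       * X p 0 a * Y p 0 b.
  apply/rowP => k; rewrite [LHS]mxE [RHS]mxE [X in _ = _ + X]mxE.
  congr (_ + _); first exact/esym/derive_sum_partial.
  by rewrite /christoffel -/i -/x gx.
rewrite !mulmxDl /lowered_nabla gx Yx; congr (_ + _).
by apply: etrans (christoffel_lower dG _ _ _ ug sg) _; rewrite !DG.
Qed.

Lemma posdef_unitmx (R : realType) m (A : 'M[R]_m) :
  (forall v : 'rV[R]_m, v != 0 -> 0 < (v *m A *m v^T) 0 0) -> A \in unitmx.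
Proof.
move=> pos; rewrite -row_free_unit -kermx_eq0; apply/rowV0P => v /sub_kermxP vA.
apply/eqP/negPn/negP => /pos; by rewrite vA mul0mx mxE ltxx.
Qed.

Lemma rV_ext (R : realType) m (u v : 'rV[R]_m) :
  (forall z : 'rV[R]_m, u *m z^T = v *m z^T) -> u = v.
Proof.
move=> uv; apply/rowP => k; have := congr1 (fun A : 'M[R]_1 => A 0 0) (uv (delta_mx 0 k)).
have e (w : 'rV[R]_m) : (w *m (delta_mx 0 k : 'rV[R]_m)^T) 0 0 = w 0 k.
  by rewrite trmx_delta -colE mxE.
by rewrite !e.
Qed.

(** * Riemannian metrics and closed conformal fields in charts *)

Section Metric.
Variables (R : realType) (m : nat) (M : manifold R m) (g : M -> 'M[R]_m).
Hypothesis g_metric : riemannian_metric g.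
Implicit Types (i j : chart_index M) (p : M) (X Y : M -> 'rV[R]_m).

Lemma riemannian_sym p : (g p)^T = g p.
Proof.
have [_ sg _] := g_metric.
have e a b : inner g p (delta_mx 0 a) (delta_mx 0 b) = g p a b.
  by rewrite /inner trmx_delta -rowE -colE !mxE.
by apply/matrixP => a b; rewrite mxE -!e sg.
Qed.

Lemma riemannian_unit p : g p \in unitmx.
Proof. by have [_ _ pg] := g_metric; apply: posdef_unitmx => v v0; exact: pg. Qed.

Lemma inner_chart i p X Y : dom i p ->
  inner g p (X p) (Y p) = (field_in X i (chart i p) *m form_in g i (chart i p)
    *m (field_in Y i (chart i p))^T) 0 0.
Proof.
move=> ip; have cp := dom_chart_at p.
rewrite !(field_in_chart _ ip) (form_in_chart _ ip) /inner.
have DC := change_mul cp ip cp; rewrite (change_id cp) in DC.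
move: DC; move: (change _ i p) (change i _ p) => D C DC.
rewrite trmx_mul !mulmxA -(mulmxA _ D) DC mulmx1.
by rewrite -(mulmxA _ C^T) -trmx_mul DC trmx1 mulmx1.
Qed.

Lemma smooth_inner X Y : smooth_field X -> smooth_field Y ->
  smooth_fun (fun p => inner g p (X p) (Y p)).
Proof.
move=> sX sY i; have oc : open (cod i) := @open_cod _ _ M i.
have [sg _ _] := g_metric.
have sXG := smooth_mulmx oc (sX i) (sg i).
have sXGY := smooth_mulmx oc sXG (smooth_trmx oc (sY i)).
move=> k; apply: (Ck_ext oc) (sXGY 0 0 k) => _ [p ip <-].
by rewrite /= chartK // (inner_chart _ _ ip).
Qed.

(** Extending the vector t to a global smooth field turns the conformal equation into a pointwise
    identity for arbitrary t and s. *)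
Lemma lowered_nabla_conformal X psi p t s : closed_conformal g X psi ->
  let i := chart_at p in let x := chart i p in
  lowered_nabla (form_in g i) (field_in X i) x t s =
    psi p *: (t *m form_in g i x *m s^T).
Proof.
move=> [sX _ cX] i x; have ix : cod i x := cod_chart (dom_chart_at p).
have [sg _ _] := g_metric.
have [Y sY Yp] := tangent_vector_extension p t.
have dg := smooth_mx_differentiable (sg i) ix.
have dX := smooth_mx_differentiable (sX i) ix.
rewrite -Yp -(nabla_lowered Y s dg dX (riemannian_unit p) (riemannian_sym p)).
by rewrite (cX Y sY p) (form_in_center g p) -!scalemxAl.
Qed.

End Metric.

(** * Pullback of functions, metrics and tangent fields along an immersion *)

Lemma smooth_fun_comp (R : realType) n m (N : manifold R n) (M : manifold R m)
    (F : N -> M) (f : M -> R) :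
  smooth_map F -> smooth_fun f -> smooth_fun (f \o F).
Proof.
move=> smF sf i k; apply: Ck_local => _ [q iq <-].
pose j := chart_at (F q).
pose W := chart i @` (dom i `&` (F @^-1` dom j)).
have oW : open W by exact: open_map_dom.
have Wq : W (chart i q) by exists q => //; split=> //; exact: dom_chart_at.
have sW : Ck k W ((f \o param j) \o (chart j \o F \o param i)).
  apply: (smooth_comp oW _ _ (sf j)); last by case: smF => _; apply.
  by move=> _ [q' [iq' jq'] <-] /=; rewrite chartK //; exact: cod_chart.
have sW' : Ck k W ((f \o F) \o param i).
  by apply: (Ck_ext oW) sW => _ [q' [iq' jq'] <-]; rewrite /= !chartK.
by apply: Ck_sub sW' => _ ->.
Qed.

Section InducedMetric.
Variables (R : realType) (n m : nat) (N : manifold R n) (M : manifold R m).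
Variables (F : N -> M) (smF : smooth_map F).
Hypothesis F_immersion : forall q, row_free (tangent_map F q).
Variables (g : M -> 'M[R]_m) (g_metric : riemannian_metric g).
Implicit Types (i : chart_index N) (j : chart_index M) (q : N).

Let h := induced_metric F g.

(** [induced_metric] is built in the charts chosen by [chart_at]; the chain rule trades a change of
    source coordinates for one of target coordinates, so the formula [J G J^T] persists in arbitrary
    charts. *)
Lemma form_in_induced i j q : dom i q -> dom j (F q) ->
  form_in h i (chart i q) =
    jac F i j q *m form_in g j (chart j (F q)) *m (jac F i j q)^T.
Proof.
move=> iq jq; have cq := dom_chart_at q; have cFq := dom_chart_at (F q).
have e : change i (chart_at q) q *m tangent_map F q =
    jac F i j q *m change j (chart_at (F q)) (F q).
  apply: etrans (change_jac smF cq iq cFq) _.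
  exact/esym/(jac_change smF iq jq cFq).
rewrite (form_in_chart _ iq) (form_in_chart _ jq) /h /induced_metric.
rewrite !mulmxA e -!mulmxA; congr (_ *m (_ *m (_ *m _))).
by rewrite -!trmx_mul e.
Qed.

Lemma induced_riemannian : riemannian_metric h.
Proof.
have [sg symg pg] := g_metric.
have innerE q u v :
    inner h q u v = inner g (F q) (u *m tangent_map F q) (v *m tangent_map F q).
  by rewrite /inner trmx_mul !mulmxA.
split=> [i|q u v|q v v0]; last 2 first.
- by rewrite !innerE symg.
- rewrite innerE; apply: pg; apply: contra_neq v0 => vT.
  by apply: (row_free_inj (F_immersion q)); rewrite mul0mx.
apply: smooth_mx_near => _ [q iq <-].
pose j := chart_at (F q); pose W := chart i @` (dom i `&` (F @^-1` dom j)).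
pose Fc := chart j \o F \o param i.
have oW : open W by exact: open_map_dom.
have Wq : W (chart i q) by exists q => //; split=> //; exact: dom_chart_at.
have sFc : smooth_mx_on W Fc by case: smF => _; apply.
have sJ := smooth_jacobian oW sFc.
have sG : smooth_mx_on W (form_in g j \o Fc).
  apply: (smooth_mx_comp oW _ sFc (sg j)).
  by move=> _ [q' [iq' jq'] <-] /=; rewrite /Fc /= chartK //; exact: cod_chart.
exists W, (fun x => jacobian Fc x *m (form_in g j \o Fc) x *m (jacobian Fc x)^T).
split; [exact: oW|exact: Wq| |].
- exact: (smooth_mulmx oW (smooth_mulmx oW sJ sG) (smooth_trmx oW sJ)).
- move=> _ [q' [iq' jq'] <-]; rewrite (form_in_induced iq' jq') /Fc /comp.
  by rewrite (chartK iq').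
Qed.

Lemma form_in_induced_unit i q : dom i q -> form_in h i (chart i q) \in unitmx.
Proof.
move=> iq; have uc := change_unit iq (dom_chart_at q).
have uh := riemannian_unit induced_riemannian q.
by rewrite (form_in_chart _ iq) !unitmx_mul unitmx_tr uc uh.
Qed.

Lemma field_in_pushforward (U : N -> 'rV[R]_n) i j q : dom i q -> dom j (F q) ->
  field_in U i (chart i q) *m jac F i j q =
    (U q *m tangent_map F q) *m change (chart_at (F q)) j (F q).
Proof.
move=> iq jq; have cq := dom_chart_at q; have cFq := dom_chart_at (F q).
rewrite (field_in_chart _ iq) -!mulmxA; congr (_ *m _).
apply: etrans (change_jac smF iq cq jq) _.
exact/esym/(jac_change smF cq cFq jq).
Qed.

(* U is recovered from its push-forward V = U J as V G J^T (J G J^T)^-1. *)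
Lemma smooth_pullback_field (U : N -> 'rV[R]_n) :
  (forall i j, smooth_mx_on (chart i @` (dom i `&` (F @^-1` dom j)))
    (fun x => field_in U i x *m jacobian (chart j \o F \o param i) x)) ->
  smooth_field U.
Proof.
move=> sUJ i; apply: smooth_mx_near => _ [q iq <-].
pose j := chart_at (F q); pose W := chart i @` (dom i `&` (F @^-1` dom j)).
pose Fc := chart j \o F \o param i; pose J := jacobian Fc.
have oW : open W by exact: open_map_dom.
have Wq : W (chart i q) by exists q => //; split=> //; exact: dom_chart_at.
have sFc : smooth_mx_on W Fc by case: smF => _; apply.
have sJ : smooth_mx_on W J by exact: smooth_jacobian.
have [sg _ _] := g_metric.
have sG : smooth_mx_on W (form_in g j \o Fc).
  apply: (smooth_mx_comp oW _ sFc (sg j)).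
  by move=> _ [q' [iq' jq'] <-] /=; rewrite /Fc /= chartK //; exact: cod_chart.
pose GJ x := (form_in g j \o Fc) x *m (J x)^T.
have sGJ : smooth_mx_on W GJ := smooth_mulmx oW sG (smooth_trmx oW sJ).
have hE x : W x -> J x *m GJ x = form_in h i x.
  move=> [q' [iq' jq'] <-]; rewrite (form_in_induced iq' jq') /GJ mulmxA /Fc.
  by rewrite /comp (chartK iq').
have uh x : W x -> J x *m GJ x \in unitmx.
  by move=> Wx; rewrite (hE x Wx); case: Wx => q' [iq' _] <-; exact: form_in_induced_unit.
have sinv := smooth_invmx oW uh (smooth_mulmx oW sJ sGJ).
exists W, (fun x => (field_in U i x *m J x) *m GJ x *m invmx (J x *m GJ x)); split.
- exact: oW.
- exact: Wq.
- exact: (smooth_mulmx oW (smooth_mulmx oW (sUJ i j) sGJ) sinv).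
- by move=> x Wx; rewrite -(mulmxA (field_in U i x)) mulmxK //; exact: uh.
Qed.

End InducedMetric.

(** * The tangential part of a closed conformal field along a leaf *)

Theorem lemma3p1 (R : realType) (n : nat) (n_ge2 : (2 <= n)%N)
    (M : manifold R n.+1) (M_oriented : oriented M)
    (g : M -> 'M[R]_(n.+1)) (g_metric : riemannian_metric g)
    (xi : M -> 'rV[R]_(n.+1)) (psi_xi : M -> R)
    (xi_cc : closed_conformal g xi psi_xi)
    (xi_nontrivial : exists p : M, xi p != 0)
    (Xi : manifold R n) (iota : Xi -> M) (Xi_leaf : leaf g xi iota)
    (xi_unit : forall q : Xi,
       inner g (iota q) (xi (iota q)) (xi (iota q)) = 1)
    (eta : M -> 'rV[R]_(n.+1)) (psi_eta : M -> R)
    (eta_cc : closed_conformal g eta psi_eta) :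
  exists U : Xi -> 'rV[R]_n,
    (forall q : Xi,
       U q *m tangent_map iota q =
       eta (iota q)
       - inner g (iota q) (eta (iota q)) (xi (iota q)) *: xi (iota q)) /\
    closed_conformal (induced_metric iota g) U
      (fun q : Xi =>
         psi_eta (iota q)
         - psi_xi (iota q) * inner g (iota q) (eta (iota q)) (xi (iota q))).
Proof.
have [[_ smI [_ imm] _ rngE] _] := Xi_leaf.
have [sxi spxi _] := xi_cc; have [seta speta _] := eta_cc.
pose f q := inner g (iota q) (eta (iota q)) (xi (iota q)).
(* Since [<xi, xi> = 1] on the leaf, [eta - f xi] is orthogonal to xi, and the orthogonal space is
   the range of the tangent map. *)
have exU q : exists w : 'rV[R]_n,
    w *m tangent_map iota q = eta (iota q) - f q *: xi (iota q).
  have : xi_orthogonal g xi (iota q) (eta (iota q) - f q *: xi (iota q)).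
    have bil (u v w : 'rV[R]_n.+1) c :
        inner g (iota q) (u - c *: v) w =
        inner g (iota q) u w - c * inner g (iota q) v w.
      by rewrite /inner !mulmxBl -!scalemxAl !mxE.
    by rewrite /xi_orthogonal /= bil xi_unit mulr1 subrr.
  by rewrite -rngE => -[w _ wE]; exists w.
(* The pointwise choice carries no regularity; smoothness of U is recovered below from that of its
   push-forward. *)
have [U UE] := choice exU; exists U; split; first exact: UE.
(* The equation defining U is needed in all pairs of charts, since [smooth_pullback_field] asks for
   a smooth push-forward in each. *)
have UJ i j q : dom i q -> dom j (iota q) ->
    field_in U i (chart i q) *m jac iota i j q =
    field_in eta j (chart j (iota q)) - f q *: field_in xi j (chart j (iota q)).
  move=> iq jq; rewrite (field_in_pushforward smI U iq jq) UE mulmxBl -scalemxAl.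
  by rewrite -!(field_in_chart _ jq).
have sf : smooth_fun f := smooth_fun_comp smI (smooth_inner g_metric seta sxi).
have sFc i j : smooth_mx_on (chart i @` (dom i `&` (iota @^-1` dom j)))
    (chart j \o iota \o param i) by case: smI => _; apply.
have UJon i j x : (chart i @` (dom i `&` (iota @^-1` dom j))) x ->
    field_in U i x *m jacobian (chart j \o iota \o param i) x =
    field_in eta j ((chart j \o iota \o param i) x)
    - (f \o param i) x *: field_in xi j ((chart j \o iota \o param i) x).
  by move=> [q [iq jq] <-]; rewrite /comp (chartK iq); exact: UJ.
have sU : smooth_field U.
  apply: (smooth_pullback_field smI imm g_metric) => i j.
  set W := chart i @` _; have oW : open W by exact: open_map_dom.
  have WF x : W x -> cod j ((chart j \o iota \o param i) x).
    by move=> [q [iq jq] <-]; rewrite /comp (chartK iq); exact: cod_chart.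
  have sfW : smooth_on W (f \o param i).
    by move=> k; apply: Ck_sub (sf i k) => _ [q [iq _] <-]; exact: cod_chart.
  have se := smooth_mx_comp oW WF (sFc i j) (seta j).
  have sx := smooth_mx_comp oW WF (sFc i j) (sxi j).
  apply: (smooth_mx_ext oW) (smooth_submx oW se (smooth_scalemx oW sfW sx)).
  by move=> x /UJon ->.
split; first exact: sU.
  move=> i; have oc : open (cod i) := @open_cod _ _ Xi i.
  have s1 := smooth_fun_comp smI spxi i; have s2 := smooth_fun_comp smI speta i.
  exact: (smooth_sub oc s2 (smooth_mul oc s1 (sf i))).
move=> X sX q.
have h_metric := induced_riemannian smI imm g_metric.
pose i := chart_at q; pose j := chart_at (iota q).
have iq : dom i q := dom_chart_at q.
have jq : dom j (iota q) := dom_chart_at (iota q).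
have [sh _ _] := h_metric; have [sg _ _] := g_metric.
pose W := chart i @` (dom i `&` (iota @^-1` dom j)).
pose Fc := chart j \o iota \o param i.
have oW : open W by exact: open_map_dom.
have Wq : W (chart i q) by exists q.
have Fchart q' : dom i q' -> Fc (chart i q') = chart j (iota q').
  by move=> iq'; rewrite /Fc /comp (chartK iq').
have Fq := Fchart q iq.
have ciq := cod_chart iq; have cjq := cod_chart jq.
have dh := smooth_mx_differentiable (sh i) ciq.
have dU := smooth_mx_differentiable (sU i) ciq.
have uh := riemannian_unit h_metric q; have symh := riemannian_sym h_metric q.
(* Both sides are compared after lowering the index: the induced metric is invertible, and a row
   vector is determined by its pairings with all z. *)
apply: (can_inj (mulmxK uh)); apply: rV_ext => z.
apply: etrans (nabla_lowered X z dh dU uh symh) _.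
have dg : differentiable (form_in g j) (Fc (chart i q)).
  by rewrite Fq; exact: smooth_mx_differentiable (sg j) cjq.
have dxi : differentiable (field_in xi j) (Fc (chart i q)).
  by rewrite Fq; exact: smooth_mx_differentiable (sxi j) cjq.
have deta : differentiable (field_in eta j) (Fc (chart i q)).
  by rewrite Fq; exact: smooth_mx_differentiable (seta j) cjq.
have symg : (form_in g j (Fc (chart i q)))^T = form_in g j (Fc (chart i q)).
  by rewrite Fq (form_in_center g); exact: riemannian_sym.
have hE x : W x -> form_in (induced_metric iota g) i x =
    jacobian Fc x *m form_in g j (Fc x) *m (jacobian Fc x)^T.
  move=> [q' [iq' jq'] <-]; rewrite (Fchart q' iq').
  exact: (form_in_induced smI g iq' jq').
have df := smooth_differentiable (sf i) ciq.
(* The rows of the tangent map are tangent to the leaf, hence orthogonal to xi. *)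
have JX : jacobian Fc (chart i q) *m form_in g j (Fc (chart i q))
    *m (field_in xi j (Fc (chart i q)))^T = 0.
  rewrite Fq (form_in_center g) (field_in_center xi).
  have TX (w : 'rV[R]_n) : (w *m (tangent_map iota q *m g (iota q)
      *m (xi (iota q))^T)) 0 0 = 0.
    rewrite !mulmxA; have : range (fun w => w *m tangent_map iota q)
      (w *m tangent_map iota q) by exists w.
    by rewrite rngE.
  apply/matrixP => a b; rewrite ord1 [RHS]mxE -(TX (delta_mx 0 a)).
  by rewrite -rowE [RHS]mxE.
have conX t s : lowered_nabla (form_in g j) (field_in xi j) (Fc (chart i q)) t s =
    psi_xi (iota q) *: (t *m form_in g j (Fc (chart i q)) *m s^T).
  by rewrite Fq; exact: (lowered_nabla_conformal g_metric (iota q) t s xi_cc).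
have conY t s : lowered_nabla (form_in g j) (field_in eta j) (Fc (chart i q)) t s =
    psi_eta (iota q) *: (t *m form_in g j (Fc (chart i q)) *m s^T).
  by rewrite Fq; exact: (lowered_nabla_conformal g_metric (iota q) t s eta_cc).
apply: etrans (lowered_nabla_tangent_part (X q) z oW Wq (sFc i j) dg symg hE dU df
  dxi deta (@UJon i j) JX conX conY) _.
have -> : (f \o param i) (chart i q) = f q by rewrite /comp (chartK iq).
by rewrite (form_in_center _ q) -!scalemxAl.
Qed.
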